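(* Let $G=(\{1,\dots,n\},E)$ be a sorted DAG, let $j<k$ be two vertices, suppose $\mathcal X_j=\{0,1\}$, $\mathcal X_k$ is a compact subset of $\mathbb R$, $d_{\mathcal X_i}(x_i,y_i)=|x_i-y_i|$ for $i=j,k$, and $d_{\mathcal X}(x,y)=\sum_{i=1}^n d_{\mathcal X_i}(x_i,y_i)$. Let $\delta>0$ be fixed. Let $G'=(\{1,\dots,n\},E')$ be another sorted DAG such that $E\subseteq E'$. Then there exists a constant $L>0$ such that $$|\psi^{\mu,G}-\psi^{\nu,G}|\le L\cdot W_{G',1}(\mu,\nu)\qquad\text{for all }\mu,\nu\in\mathcal P^{G,\delta}(\mathcal X).$$ In particular, there exists a constant $L>0$ such that $$|\psi^{\mu,G}-\psi^{\nu,G}|\le L\cdot AW_1(\mu,\nu)\qquad\text{for all }\mu,\nu\in\mathcal P^{G,\delta}(\mathcal X).$$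
   Context: Directed graphs $G=(V,E)$ have a finite vertex set $V$ and edge set $E\subseteq\{(i,j)\in V\times V: i\neq j\}$; $\mathrm{pa}_i=\{j:(j,i)\in E\}$ is the set of parents of $i$ in $G$, $\mathrm{an}_i$ is the set of ancestors of $i$ (vertices from which there is a directed path of length at least one to $i$), and $\mathrm{dsc}_i=\{j: i\in\mathrm{an}_j\}$. $G$ is a DAG if $i\notin\mathrm{an}_i$ for all $i$. A DAG on $\{1,\dots,n\}$ is sorted if $i<j$ whenever $i\in\mathrm{pa}_j$. To each $v\in V$ are associated Polish spaces $\mathcal X_v,\mathcal Y_v$ with metrics $d_{\mathcal X_v},d_{\mathcal Y_v}$; $\mathcal X=\prod_{v\in V}\mathcal X_v$ and, for $A\subseteq V$, $\mathcal X_A=\prod_{v\in A}\mathcal X_v$, with $x_A$, $X_A$ denoting projections onto $\mathcal X_A$ (similarly for $\mathcal Y$). $\mathcal P(\Omega)$ is the set of Borel probability measures on $\Omega$; $\Pi(\mu,\nu)$ is the set of couplings of $\mu$ and $\nu$. For a DAG $G$, $\mu\in\mathcal P(\mathcal X)$ is $G$-compatible if, for $X\sim\mu$ and every $i\in V$, $X_i$ is conditionally independent of $X_{V\setminus(\mathrm{dsc}_i\cup\{i\})}$ given $X_{\mathrm{pa}_i}$; $\mathcal P^G(\mathcal X)$ is the set of such measures. $\mathcal P^{G,\delta}(\mathcal X)$ is the set of $\mu\in\mathcal P^G(\mathcal X)$ with $\delta\le\mu(x_j=1\,|\,x_{\mathrm{pa}_j})\le 1-\delta$ for $\mu$-almost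 all $x_{\mathrm{pa}_j}$ (parents taken in $G$). The average treatment effect is $$\psi^{\mu,G}=\left|\int_{\mathcal X_{\mathrm{pa}_j}}\int_{\mathcal X_k}x_k\,\mu(dx_k|x_j=1,x_{\mathrm{pa}_j})\,\mu(dx_{\mathrm{pa}_j})-\int_{\mathcal X_{\mathrm{pa}_j}}\int_{\mathcal X_k}x_k\,\mu(dx_k|x_j=0,x_{\mathrm{pa}_j})\,\mu(dx_{\mathrm{pa}_j})\right|,$$ with $\mathrm{pa}_j$ the parents of $j$ in $G$. For a DAG $H=(V,F)$, $\mu\in\mathcal P^H(\mathcal X)$, $\nu\in\mathcal P^H(\mathcal Y)$: let $H^c$ be the DAG with vertex set $\{i,i':i\in V\}$ ($i'$ a copy of $i$) and edge set $\{(i,l),(i,l'),(i',l'):(i,l)\in F\}\cup\{(i,i'):i\in V\}$, with $\mathcal X_i$ associated to $i$ and $\mathcal Y_i$ to $i'$. The set of $H$-causal couplings is $\Pi_H^c(\mu,\nu)=\Pi(\mu,\nu)\cap\mathcal P^{H^c}(\mathcal X\times\mathcal Y)$. A coupling is $H$-anticausal if its pushforward under $(x,y)\mapsto(y,x)$ lies in $\Pi_H^c(\nu,\mu)$. $\Pi_H^{bc}(\mu,\nu)$ (the $H$-bicausal couplings) is the set of couplings that are both. $W_{H,1}(\mu,\nu)=\inf_{\pi\in\Pi_H^{bc}(\mu,\nu)}\int d_{\mathcal X}(x,y)\,d\pi(x,y)\in[0,\infty]$ for $\mu,\nu\in\mathcal P^H(\mathcal X)$. The adapted Wasserstein distance is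 $AW_1=W_{G_n,1}$ where $G_n=(\{1,\dots,n\},\{(i,j):1\le i<j\le n\})$. (If $E\subseteq E'$ then $\mathcal P^G(\mathcal X)\subseteq\mathcal P^{G'}(\mathcal X)$.) *)

(* Defs.v *)
From HB Require Import structures.
From mathcomp Require Import all_boot all_order all_algebra.
From mathcomp Require Import all_classical all_reals all_analysis.
From mathcomp Require Import measurable_realfun.

Set Implicit Arguments.
Unset Strict Implicit.
Unset Printing Implicit Defensive.

Import Order.TTheory GRing.Theory Num.Theory.
Import numFieldNormedType.Exports.

Local Open Scope classical_set_scope.
Local Open Scope ring_scope.

Definition separable (T : topologicalType) : Prop :=
  exists2 S : set T, countable S & dense S.

Definition completely_metrizable (R : realType) (T : topologicalType) : Prop :=
  exists d : T -> T -> R,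
    [/\ (forall x y, d x y = 0 <-> x = y),
        (forall x y, d x y = d y x),
        (forall x y z, d x z <= d x y + d y z),
        (forall x (A : set T),
           nbhs x A <-> exists2 e, 0 < e & [set y | d x y < e] `<=` A)
      & forall u : nat -> T,
          (forall e, 0 < e ->
             exists N, forall p q, (N <= p)%N -> (N <= q)%N -> d (u p) (u q) < e) ->
          exists l : T, u @ \oo --> l].

(* The metric [mdist] of a Polish space is compatible with the topology but is
   not required to be complete itself; some compatible metric must be.
   Measurable types are nonempty in the library, hence [Pointed]; a space that
   carries a probability measure is nonempty anyway. *)
HB.mixin Record Metric_isPolish (R : realType) T & Metric R T & Pointed T := {
  polish_separable : separable T ;
  polish_metrizable : completely_metrizable R T
}.

#[short(type="polishType")]
HB.structure Definition Polish (R : realType) :=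
  {T of Metric R T & Pointed T & Metric_isPolish R T}.

HB.instance Definition _ (I : Type) (T : I -> ptopologicalType) :=
  Pointed.copy (prod_topology T) (forall i, T i).

HB.instance Definition _ (T U : ptopologicalType) := Pointed.on (T * U)%type.

Notation borel T := (g_sigma_algebraType (@open T)).

Lemma continuous_borel (T U : ptopologicalType) (f : T -> U) :
  continuous f -> measurable_fun setT (f : borel T -> borel U).
Proof.
move=> cf; apply: (@measurability _ _ (borel T) (borel U) _ _ (@open U)) => //.
move=> _ [B oB <-]; rewrite setTI; apply: sub_sigma_algebra.
by move/continuousP : cf; exact.
Qed.

Section Graphs.
Variable V : finType.
Implicit Types E : rel V.

Definition pa E (i : V) : {set V} := [set j | E j i].

Definition an E (i : V) : {set V} := [set j | [exists l, E j l && connect E l i]].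

Definition dsc E (i : V) : {set V} := [set j | i \in an E j].

Definition dag E : Prop := forall i, i \notin an E i.

(* The graph H^c: [inl i] is the vertex i and [inr i] its copy i'. *)
Definition causal_graph E : rel (V + V) := fun s t =>
  match s, t with
  | inl i, inl l => E i l
  | inl i, inr l => E i l || (i == l)
  | inr i, inr l => E i l
  | inr _, inl _ => false
  end.

End Graphs.

Definition sorted_dag (n : nat) (E : rel 'I_n) : Prop :=
  dag E /\ forall i j : 'I_n, i \in pa E j -> (i < j)%N.

Definition complete_graph (n : nat) : rel 'I_n := fun i j => (i < j)%N.

Section Conditioning.
Local Open Scope ereal_scope.
Context (R : realType) (d : measure_display) (Om : measurableType d).
Variable P : probability Om R.

(* f(z) is a version of P(A | Z = z). *)
Definition cond_prob d1 (S : measurableType d1) (Z : Om -> S) (A : set Om)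
    (f : S -> \bar R) : Prop :=
  [/\ measurable_fun setT f, (forall z, 0 <= f z) &
      forall C : set S, measurable C ->
        P (A `&` Z @^-1` C) = \int[P]_(w in Z @^-1` C) f (Z w)].

Definition cond_law d1 d2 (S : measurableType d1) (T : measurableType d2)
    (Z : Om -> S) (U : Om -> T) (kappa : R.-pker S ~> T) : Prop :=
  forall B : set T, measurable B ->
    cond_prob Z (U @^-1` B) (fun z => kappa z B).

Definition cond_indep d1 d2 d3 (T1 : measurableType d1) (T2 : measurableType d2)
    (S : measurableType d3) (U : Om -> T1) (W : Om -> T2) (Z : Om -> S) : Prop :=
  forall (A : set T1) (B : set T2), measurable A -> measurable B ->
    exists f g : S -> \bar R,
      [/\ cond_prob Z (U @^-1` A) f, cond_prob Z (W @^-1` B) g &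
          cond_prob Z (U @^-1` A `&` W @^-1` B) (fun z => f z * g z)].

End Conditioning.

Definition product_space (R : realType) (V : finType) (X : V -> polishType R) :
  ptopologicalType := prod_topology (fun v => X v : ptopologicalType).

Definition product_on (R : realType) (V : finType) (X : V -> polishType R)
    (A : {set V}) : ptopologicalType :=
  prod_topology (fun v : {v | v \in A} => X (val v) : ptopologicalType).

Definition joint (R : realType) (V : finType) (X : V -> polishType R) Om
    (Z : forall v, Om -> X v) (A : {set V}) (w : Om) : product_on X A :=
  fun v => Z (val v) w.
Arguments joint {R V X Om} Z A w.

(* Compatibility of the law of a family (Z_v) of random elements on Om; for the
   coordinate maps of a product space this is compatibility of the measure. *)
Definition compatible (R : realType) (V : finType) (X : V -> polishType R)
    (E : rel V) (d : measure_display) (Om : measurableType d)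
    (P : probability Om R) (Z : forall v, Om -> X v) : Prop :=
  forall i : V,
    cond_indep P (Z i : Om -> borel (X i))
      (joint Z (~: (dsc E i :|: [set i])) : Om -> borel (product_on X _))
      (joint Z (pa E i) : Om -> borel (product_on X _)).

Definition coord (R : realType) (V : finType) (X : V -> polishType R) (v : V)
  (x : borel (product_space X)) : X v := x v.

Definition restr (R : realType) (V : finType) (X : V -> polishType R)
    (A : {set V}) (x : borel (product_space X)) : borel (product_on X A) :=
  joint (@coord R V X) A x.
Arguments restr {R V X} A x.

Lemma continuous_restr (R : realType) (V : finType) (X : V -> polishType R)
    (A : {set V}) :
  continuous (@restr R V X A : product_space X -> product_on X A).
Proof.
move=> x; apply/cvg_sup => v; move: x.
apply/(@continuousP _ (initial_topology (@^~ v))) => _ [B oB <-].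
rewrite -comp_preimage; apply: open_comp => // y _.
exact: (@proj_continuous V (fun u => X u : ptopologicalType) (val v)).
Qed.

HB.instance Definition _ (R : realType) (V : finType) (X : V -> polishType R)
    (A : {set V}) :=
  isMeasurableFun.Build _ _ (borel (product_space X)) (borel (product_on X A))
    (@restr R V X A) (continuous_borel (@continuous_restr R V X A)).

Definition compatible_measures (R : realType) (V : finType)
    (X : V -> polishType R) (E : rel V) :
    set (probability (borel (product_space X)) R) :=
  [set mu | compatible E mu (@coord R V X)].

Section Couplings.
Local Open Scope ereal_scope.
Context (R : realType) (V : finType).
Implicit Types (X Y : V -> polishType R) (H : rel V).

Definition pair_space X Y : ptopologicalType :=
  (product_space X * product_space Y)%type.

Definition couplings X Y (mu : probability (borel (product_space X)) R)
    (nu : probability (borel (product_space Y)) R) :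
    set (probability (borel (pair_space X Y)) R) :=
  [set pi | (forall A : set (borel (product_space X)), measurable A ->
               pi [set z | A z.1] = mu A) /\
            (forall B : set (borel (product_space Y)), measurable B ->
               pi [set z | B z.2] = nu B)].

Definition sum_family X Y (s : V + V) : polishType R :=
  match s with inl i => X i | inr i => Y i end.

Definition pair_proj X Y (s : V + V) (z : borel (pair_space X Y)) :
    sum_family X Y s :=
  match s with inl i => z.1 i | inr i => z.2 i end.

Definition causal_couplings X Y H (mu : probability (borel (product_space X)) R)
    (nu : probability (borel (product_space Y)) R) :
    set (probability (borel (pair_space X Y)) R) :=
  couplings mu nu `&`
  [set pi | compatible (causal_graph H) pi (@pair_proj X Y)].

Definition swap_pair X Y (z : borel (pair_space X Y)) : borel (pair_space Y X) :=
  (z.2, z.1).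

Lemma continuous_swap_pair X Y :
  continuous (@swap_pair X Y : pair_space X Y -> pair_space Y X).
Proof. exact: (@swap_continuous (product_space X) (product_space Y)). Qed.

HB.instance Definition _ X Y :=
  isMeasurableFun.Build _ _ (borel (pair_space X Y)) (borel (pair_space Y X))
    (@swap_pair X Y) (continuous_borel (@continuous_swap_pair X Y)).

Definition anticausal_couplings X Y H
    (mu : probability (borel (product_space X)) R)
    (nu : probability (borel (product_space Y)) R) :
    set (probability (borel (pair_space X Y)) R) :=
  [set pi | causal_couplings H nu mu (distribution pi (@swap_pair X Y))].

Definition bicausal_couplings X Y H (mu : probability (borel (product_space X)) R)
    (nu : probability (borel (product_space Y)) R) :
    set (probability (borel (pair_space X Y)) R) :=
  causal_couplings H mu nu `&` anticausal_couplings H mu nu.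

Definition wasserstein X H (dX : product_space X -> product_space X -> R)
    (mu nu : probability (borel (product_space X)) R) : \bar R :=
  ereal_inf [set \int[pi]_z (dX z.1 z.2)%:E | pi in bicausal_couplings H mu nu].

End Couplings.

Definition adapted_wasserstein (R : realType) (n : nat)
    (X : 'I_n -> polishType R) (dX : product_space X -> product_space X -> R)
    (mu nu : probability (borel (product_space X)) R) : \bar R :=
  wasserstein (@complete_graph n) dX mu nu.

Definition sum_dist (R : realType) (V : finType) (X : V -> polishType R)
    (x y : product_space X) : R :=
  \sum_(i : V) mdist (x i) (y i).

Section TreatmentEffect.
Context (R : realType) (V : finType) (X : V -> polishType R) (E : rel V).
Variables j k : V.
(* [tr] identifies {0,1} with X_j: [tr true] is 1 and [tr false] is 0. *)
Variable tr : bool -> X j.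

Definition overlap_measures (delta : R) :
    set (probability (borel (product_space X)) R) :=
  [set mu | compatible_measures E mu /\
     exists2 kappa : R.-pker (borel (product_on X (pa E j))) ~> (borel (X j)),
       cond_law mu (restr (pa E j)) (@coord R V X j : _ -> borel (X j)) kappa &
       {ae (distribution mu (restr (pa E j))),
          forall p, (delta%:E <= kappa p [set tr true] <= (1 - delta)%:E)%E}].

(* [rv] is the inclusion of X_k in the real line. *)
Variable rv : X k -> R.

Definition treatment_space : ptopologicalType :=
  (X j * product_on X (pa E j))%type.

Definition treatment (x : borel (product_space X)) : borel treatment_space :=
  (x j, restr (pa E j) x).

Definition adjusted_mean (mu : probability (borel (product_space X)) R)
    (kappa : R.-pker (borel treatment_space) ~> (borel (X k))) (a : bool) : R :=
  \int[distribution mu (restr (pa E j))]_p \int[kappa (tr a, p)]_y rv y.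

(* The value does not depend on the version of the conditional law of X_k given
   (X_j, X_pa) as soon as mu lies in [overlap_measures delta] with delta > 0. *)
Definition ate (mu : probability (borel (product_space X)) R) : R :=
  xget 0 [set r | exists2 kappa : R.-pker (borel treatment_space) ~> (borel (X k)),
    cond_law mu treatment (@coord R V X k : _ -> borel (X k)) kappa &
    r = `|adjusted_mean mu kappa true - adjusted_mean mu kappa false| ].

End TreatmentEffect.

(* Main.v *)
(* Let e_a(p) = P(X_j = a | X_pa = p) be the propensity, which lies in
   [delta, 1 - delta].  Inverse propensity weighting turns the adjusted mean
   into E[1(X_j = a) X_k / e_a(X_pa)], an expression that no longer involves
   the conditional law of X_k.  Let (X, Y) be a bicausal coupling for G'.
   Causality and G-compatibility say that e_a(X_pa) is the conditional
   probability of X_j = a given all coordinates of both X and Y before j;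
   anticausality says the same of Y.  Hence the difference of the two
   propensities is the conditional expectation of 1(X_j = a) - 1(Y_j = a) and
   E|e_a(X_pa) - e'_a(Y_pa)| <= E|X_j - Y_j|.  Since outcomes are bounded and
   propensities are bounded below, the weighted outcome is Lipschitz in the
   indicator, the outcome and the propensity, which bounds the difference by a
   multiple of E d(X, Y).  Outcomes are shifted by a bound M to be nonnegative;
   the shift cancels between the two treatment arms. *)
From HB Require Import structures.
Require Import Defs.
From mathcomp Require Import all_boot all_order all_algebra finmap.
From mathcomp Require Import all_classical all_reals all_analysis.
From mathcomp Require Import measurable_realfun.
From mathcomp Require Import ring lra.
Import Order.TTheory GRing.Theory Num.Theory.
Import numFieldNormedType.Exports.
Local Open Scope classical_set_scope.
Local Open Scope ring_scope.

Set Implicit Arguments.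
Unset Strict Implicit.
Unset Printing Implicit Defensive.

(** * Conditional probabilities *)

Section Measure.
Local Open Scope ereal_scope.
Import HBNNSimple.

(** The definition of [ate] picks some conditional law of X_k and falls back to 0 if there is none,
    so its value is meaningful only once such a law is known to exist. The parent spaces are
    arbitrary Polish spaces, but X_k embeds isometrically as a compact subset of the line, which
    makes a quantile construction possible. The choice of the law is harmless: the estimate for one
    arm holds for any two kernels. Conditional independence enters only through identities of
    integrals over events. To compare the propensities e and e', two events are enough: {e' < e} and
    its complement, both determined by coordinates before j. Pointwise estimates would suffer from
    exceptional null sets, so versions are first truncated to satisfy their bounds everywhere:
    conditional probabilities from above at 1, propensities from below at delta. *)

Lemma ge0_nondecreasing_limeMl (R : realType) (a : \bar R) (u : (\bar R)^nat) :
  0 <= a -> (forall n, 0 <= u n) -> nondecreasing_seq u ->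
  limn (fun n => a * u n) = a * limn u.
Proof.
move=> a0 u0 ndu; have cu : cvgn u by exact: ereal_nondecreasing_is_cvgn.
case: a a0 => [r r0|_|//]; first by rewrite limeMl.
have [uE0|/existsNP[m /eqP um]] := pselect (forall n, u n = 0).
  rewrite (_ : u = cst 0); last exact/funext.
  by rewrite /= mule0 !lim_cst// mule0.
have um0 : 0 < u m by rewrite lt0e um u0.
(* With [a = +oo] both sides are infinite: by monotonicity the sequence is positive from [m] on, so
   the products are eventually [+oo]. *)
rewrite gt0_mulye//; last first.
  by apply: lt_le_trans um0 _; apply: lime_ge => //; exists m => // n; exact: ndu.
apply/cvg_lim => //; apply: cvg_near_cst; exists m => // n mn.
by rewrite gt0_mulye//; exact: lt_le_trans um0 (ndu _ _ mn).
Qed.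

(** The standard machine for nonnegative functions. Scaling by finite reals is enough, since
    infinite values arise in the monotone limit of simple functions. *)
Lemma nonneg_measurable_ind d (T : measurableType d) (R : realType)
    (Q : (T -> \bar R) -> Prop) :
  (forall A, measurable A -> Q (fun x => (\1_A x)%:E)) ->
  (forall f g, measurable_fun setT f -> measurable_fun setT g ->
     (forall x, 0 <= f x) -> (forall x, 0 <= g x) -> Q f -> Q g ->
     Q (fun x => f x + g x)) ->
  (forall (r : R) f, (0 <= r)%R -> measurable_fun setT f ->
     (forall x, 0 <= f x) -> Q f -> Q (fun x => r%:E * f x)) ->
  (forall f_ : (T -> \bar R)^nat, (forall n, measurable_fun setT (f_ n)) ->
     (forall n x, 0 <= f_ n x) -> (forall x, nondecreasing_seq (f_ ^~ x)) ->
     (forall n, Q (f_ n)) -> Q (fun x => limn (f_ ^~ x))) ->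
  forall f, measurable_fun setT f -> (forall x, 0 <= f x) -> Q f.
Proof.
move=> Qi QD QZ Ql f mf f0.
have Q0 : Q (cst 0).
  by rewrite [X in Q X](_ : _ = fun x => (\1_(@set0 T) x)%:E); [exact: Qi|
    apply/funext => x; rewrite indic0].
have Qs (g : {nnsfun T >-> R}) : Q (fun x => (g x)%:E).
  rewrite [X in Q X](_ : _ = fun x =>
    \sum_(r <- fset_set (range g)) (r%:E * (\1_(g @^-1` [set r]) x)%:E)); last first.
    apply/funext => x; rewrite fimfunE fsbig_finite//= -sumEFin.
    by apply: eq_bigr => r _; rewrite EFinM.
  have : forall r, r \in enum_fset (fset_set (range g)) -> (0 <= r)%R.
    move=> r rg; have : r \in fset_set (range g) by [].
    by rewrite in_fset_set// inE => -[x _ <-].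
  elim: (enum_fset _) => [_|r s ih rs].
    by rewrite [X in Q X](_ : _ = cst 0)//; apply/funext => x; rewrite big_nil.
  have {}ih : Q (fun x => \sum_(r0 <- s) r0%:E * (\1_(g @^-1` [set r0]) x)%:E).
    by apply: ih => r' r's; apply: rs; rewrite in_cons r's orbT.
  have r0 : (0 <= r)%R by apply: rs; rewrite in_cons eqxx.
  rewrite [X in Q X](_ : _ = fun x => r%:E * (\1_(g @^-1` [set r]) x)%:E +
    \sum_(r0 <- s) r0%:E * (\1_(g @^-1` [set r0]) x)%:E); last first.
    by apply/funext => x; rewrite big_cons.
  have mi (a : R) : measurable_fun [set: T] (fun x => (\1_(g @^-1` [set a]) x)%:E).
    by apply/measurable_EFinP/measurable_indic.
  apply: QD => //.
  - exact: measurable_funeM.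
  - by apply: emeasurable_sum => a; exact: measurable_funeM.
  - by move=> x; rewrite mule_ge0 ?lee_fin.
  - move=> x; rewrite big_seq; apply: sume_ge0 => a as_; rewrite mule_ge0 ?lee_fin//.
    by apply: rs; rewrite in_cons as_ orbT.
  - by apply: QZ => //; exact: Qi.
pose f_ := nnsfun_approx measurableT mf.
rewrite [X in Q X](_ : _ = fun x => limn (fun n => (f_ n x)%:E)); last first.
  by apply/funext => x; apply/esym/cvg_lim => //; exact: cvg_nnsfun_approx.
apply: Ql => //.
- by move=> n; exact/measurable_EFinP.
- by move=> n x; rewrite lee_fin.
- by move=> x m n mn; rewrite lee_fin; exact/lefP/nd_nnsfun_approx.
Qed.

Context d (Om : measurableType d) (R : realType) (P : probability Om R).

Lemma integral_indicM (D : set Om) (f : Om -> \bar R) :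
  \int[P]_w ((\1_D w)%:E * f w) = \int[P]_(w in D) f w.
Proof.
rewrite [RHS]integral_mkcond; apply: eq_integral => w _.
by rewrite epatch_indic muleC.
Qed.

Lemma preimage_measurable d1 (S : measurableType d1) (Z : Om -> S) C :
  measurable_fun setT Z -> measurable C -> measurable (Z @^-1` C).
Proof. by move=> mZ mC; rewrite -[X in measurable X]setTI; exact: mZ. Qed.

(** The definition of [cond_prob] tests against events of [Z]; linearity and monotone convergence
    extend it to nonnegative functions of [Z]. Read from right to left, it trades a propensity for
    the indicator of the event. *)
Lemma cond_prob_integral d1 (S : measurableType d1) (Z : Om -> S) (A : set Om)
    (f phi : S -> \bar R) :
  measurable_fun setT Z -> measurable A -> cond_prob P Z A f ->
  measurable_fun setT phi -> (forall z, 0 <= phi z) ->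
  \int[P]_(w in A) phi (Z w) = \int[P]_w (phi (Z w) * f (Z w)).
Proof.
move=> mZ mA [mf f0 fP]; move: phi.
have mfZ : measurable_fun setT (f \o Z) by exact: measurableT_comp.
apply: nonneg_measurable_ind => [C mC|g h mg mh g0 h0 IHg IHh|r g r0 mg g0 IH
  |g_ mg g0 ndg IH].
- rewrite integral_indicM -(fP _ mC) setIC -integral_indic//.
  exact: preimage_measurable.
- rewrite ge0_integralD//; [|exact/measurable_funTS/measurableT_comp..].
  rewrite IHg IHh -ge0_integralD//.
  + by apply: eq_integral => w _; rewrite ge0_muleDl.
  + by move=> w _; rewrite mule_ge0.
  + by apply: emeasurable_funM => //; exact: measurableT_comp.
  + by move=> w _; rewrite mule_ge0.
  + by apply: emeasurable_funM => //; exact: measurableT_comp.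
- rewrite ge0_integralZl_EFin//; last exact/measurable_funTS/measurableT_comp.
  rewrite IH -ge0_integralZl_EFin//.
  + by apply: eq_integral => w _; rewrite muleA.
  + by move=> w _; rewrite mule_ge0.
  + by apply: emeasurable_funM => //; exact: measurableT_comp.
- rewrite monotone_convergence//; last first.
    by move=> n; exact/measurable_funTS/measurableT_comp.
  under eq_fun do rewrite IH.
  rewrite -monotone_convergence//.
  + apply: eq_integral => w _.
    by rewrite muleC -ge0_nondecreasing_limeMl//; under eq_fun do rewrite muleC.
  + by move=> n; apply: emeasurable_funM => //; exact: measurableT_comp.
  + by move=> n w _; rewrite mule_ge0.
  + by move=> w _ m n mn; rewrite lee_wpmul2r//; exact: ndg.
Qed.

End Measure.

Section Conditional.
Local Open Scope ereal_scope.
Context d (Om : measurableType d) (R : realType) (P : probability Om R).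
Context d1 (S : measurableType d1) (Z : Om -> S).
Hypothesis mZ : measurable_fun setT Z.

(** Disintegration of the joint law of [Z] and [U]. With [phi] fixed, the induction runs over [h];
    its indicator case is [cond_prob_integral] for the version [kappa ^~ B]. *)
Lemma cond_law_integral d2 (T : measurableType d2) (U : Om -> T)
    (kappa : R.-pker S ~> T) (phi : S -> \bar R) (h : T -> \bar R) :
  measurable_fun setT U -> cond_law P Z U kappa ->
  measurable_fun setT phi -> (forall z, 0 <= phi z) ->
  measurable_fun setT h -> (forall y, 0 <= h y) ->
  \int[P]_w (phi (Z w) * h (U w)) =
  \int[P]_w (phi (Z w) * \int[kappa (Z w)]_y h y).
Proof.
move=> mU kP mphi phi0; move: h.
have mphiZ : measurable_fun setT (phi \o Z) by exact: measurableT_comp.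
have mint g : measurable_fun setT g -> (forall y, 0 <= g y) ->
    measurable_fun setT (fun w => \int[kappa (Z w)]_y g y).
  move=> mg g0; apply: (measurableT_comp (f := fun s => \int[kappa s]_y g y)) => //.
  by apply: measurable_fun_integral_kernel => // B mB; exact: measurable_kernel.
have mm g : measurable_fun setT g ->
    measurable_fun setT (fun w => phi (Z w) * g (U w)).
  by move=> mg; apply: emeasurable_funM => //; exact: measurableT_comp.
have mmi g : measurable_fun setT g -> (forall y, 0 <= g y) ->
    measurable_fun setT (fun w => phi (Z w) * \int[kappa (Z w)]_y g y).
  by move=> mg g0; apply: emeasurable_funM => //; exact: mint.
have i0 g w : (forall y, 0 <= g y) -> 0 <= \int[kappa (Z w)]_y g y.
  by move=> g0; exact: integral_ge0.
apply: nonneg_measurable_ind => [B mB|g h mg mh g0 h0 IHg IHh|r g r0 mg g0 IH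
  |g_ mg g0 ndg IH].
- under eq_integral do rewrite muleC.
  rewrite (integral_indicM P (U @^-1` B)).
  rewrite (cond_prob_integral (f := fun z => kappa z B)) //; last exact: kP.
    by apply: eq_integral => w _; rewrite integral_indic// setIT.
  exact: preimage_measurable.
- under eq_integral do rewrite ge0_muleDr//.
  rewrite ge0_integralD; [|exact: measurableT|by move=> *; rewrite mule_ge0|exact: mm|
    by move=> *; rewrite mule_ge0|exact: mm].
  rewrite IHg IHh -ge0_integralD; [|exact: measurableT|by move=> *; rewrite mule_ge0// i0|
    exact: mmi|by move=> *; rewrite mule_ge0// i0|exact: mmi].
  by apply: eq_integral => w _; rewrite ge0_integralD// [RHS]ge0_muleDr//; exact: i0.
- under eq_integral do rewrite muleCA.
  rewrite ge0_integralZl_EFin; [|exact: measurableT|by move=> *; rewrite mule_ge0|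
    exact: mm|exact: r0].
  rewrite IH -ge0_integralZl_EFin; [|exact: measurableT|
    by move=> *; rewrite mule_ge0// i0|exact: mmi|exact: r0].
  by apply: eq_integral => w _; rewrite ge0_integralZl_EFin// muleCA.
- under eq_integral do rewrite -ge0_nondecreasing_limeMl//.
  rewrite monotone_convergence//; [|by move=> n; exact: mm|
    by move=> *; rewrite mule_ge0|
    by move=> w _ m n mn; apply: lee_wpmul2l => //; exact: ndg].
  under eq_fun do rewrite IH.
  rewrite -monotone_convergence//; [|by move=> n; exact: mmi|
    by move=> *; rewrite mule_ge0// i0|].
    apply: eq_integral => w _; rewrite ge0_nondecreasing_limeMl//.
    + by rewrite monotone_convergence// => y _; exact: ndg.
    + by move=> n; exact: i0.
    + move=> m n mn; apply: ge0_le_integral => // y _; exact: ndg.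
  move=> w _ m n mn; apply: lee_wpmul2l => //.
  by apply: ge0_le_integral => // y _; exact: ndg.
Qed.

(* The two versions f and f' of P(U in A | Z) are exchanged inside the integral
   over the event against a function of Z, without any null-set argument. *)
Lemma cond_indep_cond_prob d2 d3 (T1 : measurableType d2)
    (T2 : measurableType d3) (U : Om -> T1) (W : Om -> T2) (A : set T1)
    (B : set T2) (f : S -> \bar R) :
  measurable_fun setT U -> measurable_fun setT W -> cond_indep P U W Z ->
  measurable A -> measurable B -> cond_prob P Z (U @^-1` A) f ->
  P (U @^-1` A `&` W @^-1` B) = \int[P]_(w in W @^-1` B) f (Z w).
Proof.
move=> mU mW indep mA mB fP.
have [f' [g [f'P gP [_ _ /(_ setT measurableT)]]]] := indep A B mA mB.
rewrite preimage_setT setIT => ->.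
have [mf f0 _] := fP; have [mg g0 _] := gP.
under eq_integral do rewrite muleC.
rewrite -(cond_prob_integral mZ _ f'P)//; last exact: preimage_measurable.
rewrite (cond_prob_integral mZ _ fP)//; last exact: preimage_measurable.
rewrite (cond_prob_integral mZ _ gP)//; last exact: preimage_measurable.
by apply: eq_integral => w _; rewrite muleC.
Qed.


End Conditional.

Section ConditionalProbability.
Local Open Scope ereal_scope.
Context d (Om : measurableType d) (R : realType) (P : probability Om R).
Context d1 (S : measurableType d1) (Z : Om -> S).
Hypothesis mZ : measurable_fun setT Z.

(** The integral of a version over an event of [Z] is the probability of a smaller event, hence at
    most the integral of 1. So the part of a version above 1 carries no mass, and truncation at 1
    gives a version again. *)
Lemma le_cond_prob_cst1 A f (C : set S) : measurable A -> measurable C ->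
  cond_prob P Z A f -> (forall s, C s -> 1 <= f s) ->
  \int[P]_(w in Z @^-1` C) f (Z w) = \int[P]_(w in Z @^-1` C) 1.
Proof.
move=> mA mC [mf f0 fP] f1; have mZC := preimage_measurable mZ mC.
apply/eqP; rewrite eq_le; apply/andP; split; last first.
  apply: ge0_le_integral => //; [|by move=> w; exact: f1].
  exact/measurable_funTS/measurableT_comp.
by rewrite -(fP _ mC) integral_cst// mul1e le_measure ?inE//; exact: measurableI.
Qed.

(** The function is the Radon-Nikodym derivative of C -> P(A, Z in C) with respect to the law of
    [Z], cut off at 1. Its bounds hold at every point, so its values can serve as lengths of
    subintervals of [0, 1]. *)
Lemma cond_prob_exists (A : set Om) : measurable A ->
  exists f : S -> R, [/\ measurable_fun setT f, forall s, (0 <= f s <= 1)%R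
    & cond_prob P Z A (EFin \o f)].
Proof.
move=> mA.
pose rho := distribution P (mfun_Sub (mem_set mZ : Z \in mfun)).
pose m1 : {measure set Om -> \bar R} := mrestr P mA.
pose nu_ : {measure set S -> \bar R} := pushforward m1 Z.
pose nu := nu_ mZ.
have nuE C : nu C = P (Z @^-1` C `&` A) by [].
have rhoE C : rho C = P (Z @^-1` C) by [].
have fnu : fin_num_fun nu.
  move=> C mC; rewrite nuE fin_num_measure//; apply: measurableI => //.
  exact: preimage_measurable.
pose nuf : {finite_measure set S -> \bar R} :=
  HB.pack (Measure.sort nu) (@Measure_isFinite.Build _ _ _ nu fnu).
have nurho : nuf `<< rho.
  apply/null_content_dominatesP => C mC rhoC; apply/eqP.
  rewrite -measure_le0 -rhoC; have mZC := preimage_measurable mZ mC.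
  have : P (Z @^-1` C `&` A) <= P (Z @^-1` C).
    by apply: le_measure; rewrite ?inE//; exact: measurableI.
  by [].
have [f [f0 fi fE]] := radon_nikodym_finite nurho.
have mf : measurable_fun setT f by exact: measurable_int fi.
have fP : cond_prob P Z A f.
  split=> // C mC; rewrite setIC -nuE [LHS](fE C mC).
  by rewrite ge0_integral_pushforward//; exact: measurable_funTS.
pose g s := mine (f s) 1.
have mg : measurable_fun setT g by exact: measurable_mine.
have g0 s : 0 <= g s by rewrite le_min f0/=.
have g1 s : g s <= 1 by rewrite ge_min lexx orbT.
have gE s : (fine (g s))%:E = g s.
  by rewrite fineK// ge0_fin_numE// (le_lt_trans (g1 s))// ltry.
exists (fine \o g); split.
- exact: measurableT_comp.
- by move=> s; rewrite -!lee_fin gE g0 g1.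
rewrite (_ : _ \o _ = g); last by apply/funext => s /=; rewrite gE.
split=> // C mC; have [_ _ /(_ C mC) ->] := fP.
(* Truncation can change [f] only on [D], where [le_cond_prob_cst1] shows that the integral stays
   the same. *)
pose D := f @^-1` `[1, +oo[.
have mD : measurable D by apply: preimage_measurable mf _; exact: emeasurable_itv.
have mZ' B := preimage_measurable (C := B) mZ.
have mfZ B : measurable_fun B (f \o Z) by exact/measurable_funTS/measurableT_comp.
have mgZ B : measurable_fun B (g \o Z) by exact/measurable_funTS/measurableT_comp.
rewrite -(setUIDK C D) preimage_setU.
have mCD := mZ' _ (measurableI _ _ mC mD).
have mCD' := mZ' _ (measurableD mC mD).
have dis : [disjoint Z @^-1` (C `&` D) & Z @^-1` (C `\` D)].
  by rewrite disj_set2E; apply/eqP/seteqP; split => // w [[_ ?] [_]].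
rewrite ge0_integral_setU// [RHS]ge0_integral_setU//; congr (_ + _).
- rewrite (le_cond_prob_cst1 mA _ fP); first last.
  + by move=> s [_]; rewrite /D/= in_itv/= andbT.
  + exact: measurableI.
  apply: eq_integral => w; rewrite inE => -[_]; rewrite /D/= in_itv/= andbT => f1.
  by rewrite /g; apply/esym/min_idPr.
- apply: eq_integral => w; rewrite inE => -[_]; rewrite /D/= in_itv/= andbT.
  by move=> /negP; rewrite -ltNge => f1; rewrite /g; apply/esym/min_idPl/ltW.
Qed.

End ConditionalProbability.

(** * Existence of regular conditional laws *)

Lemma measurable_section d1 d2 d3 (S : measurableType d1) (T : measurableType d2)
    (U : measurableType d3) (h : S * T -> U) (s : S) :
  measurable_fun setT h -> measurable_fun setT (fun t => h (s, t)).
Proof. by move=> mh; exact: measurableT_comp. Qed.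

Section RandomizationKernel.
Local Open Scope ereal_scope.
Context d1 d2 (S : measurableType d1) (T : measurableType d2) (R : realType).
Variable h : S * measurableTypeR R -> T.
Hypothesis mh : measurable_fun setT h.

(** A kernel in sampling form: uniform noise is fed to [h]. Measurability in [s] then follows from
    joint measurability of [h] through sections. *)
Definition rand_kernel (s : S) : {measure set T -> \bar R} :=
  distribution (uniform_prob (@ltr01 R))
    (mfun_Sub (mem_set (measurable_section s mh))).

Lemma rand_kernelE s B :
  rand_kernel s B = uniform_prob (@ltr01 R) [set t | B (h (s, t))].
Proof. by []. Qed.

Let measurable_rand_kernel B : measurable B ->
  measurable_fun setT (rand_kernel ^~ B).
Proof.
move=> mB; have mhB := preimage_measurable mh mB.
apply: (eq_measurable_fun (uniform_prob (@ltr01 R) \o xsection (h @^-1` B))).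
  move=> s _; rewrite rand_kernelE/=; congr (uniform_prob _ _).
  by apply/seteqP; split => t /=; rewrite /xsection/= inE.
exact: measurable_fun_xsection.
Qed.

HB.instance Definition _ := isKernel.Build _ _ S T R rand_kernel
  measurable_rand_kernel.

Let rand_kernel_setT s : rand_kernel s setT = 1.
Proof. exact: probability_setT. Qed.

HB.instance Definition _ := Kernel_isProbability.Build _ _ S T R rand_kernel
  rand_kernel_setT.

End RandomizationKernel.

Lemma uniform01_lt (R : realType) (a : R) : 0 <= a <= 1 ->
  uniform_prob (@ltr01 R) [set t | t < a] = a%:E.
Proof.
move=> /andP[a0 a1]; rewrite /uniform_prob integral_uniform_pdf.
rewrite (_ : _ `&` _ = `[0, a[%classic); last first.
  apply/seteqP; split => t /=; rewrite !in_itv/=.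
    by move=> [-> /andP[->]].
  by move=> /andP[-> ta]; split => //; rewrite (ltW (lt_le_trans ta a1)).
rewrite (eq_integral (fun=> 1%E)); last first.
  move=> t; rewrite inE/= in_itv/= => /andP[t0 ta].
  by rewrite /uniform_pdf t0 (ltW (lt_le_trans ta a1)) subr0 invr1.
rewrite integral_cst//= mul1e lebesgue_measure_itv/= lte_fin.
by case: ltP => [|a0']; rewrite ?sube0//; have -> : a = 0 by apply/eqP; rewrite eq_le a0'.
Qed.

Lemma ge0_integral_law d (Om : measurableType d) (R : realType)
    (P : probability Om R) d1 (S : measurableType d1) (Z : Om -> S)
    (mZ : measurable_fun setT Z) (C : set S) (k : S -> \bar R) :
  measurable C -> measurable_fun setT k -> (forall s, 0 <= k s)%E ->
  (\int[distribution P (mfun_Sub (mem_set mZ))]_(s in C) k s =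
   \int[P]_(w in Z @^-1` C) k (Z w))%E.
Proof.
by move=> mC mk k0; rewrite ge0_integral_pushforward//; exact: measurable_funTS.
Qed.

Section ConditionalLaw.
Local Open Scope ereal_scope.
Context d (Om : measurableType d) (R : realType) (P : probability Om R).
Context d1 (S : measurableType d1) (Z : Om -> S).
Hypothesis mZ : measurable_fun setT Z.

Lemma cond_law_generated d2 (T : measurableType d2) (V : Om -> T)
    (G : set (set T)) (kappa : R.-pker S ~> T) :
  measurable_fun setT V -> @measurable _ T = <<s G >> -> setI_closed G ->
  (forall B, G B -> cond_prob P Z (V @^-1` B) (fun s => kappa s B)) ->
  cond_law P Z V kappa.
Proof.
move=> mV mG GI GP B; rewrite mG; move: B.
have mk B C : measurable B -> measurable_fun C (fun w => kappa (Z w) B).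
  move=> mB; apply/measurable_funTS.
  by apply: (measurableT_comp (f := kappa ^~ B)) => //; exact: measurable_kernel.
apply: (dynkin_induction mG) => //.
- split=> [|z|C mC]; [exact: measurable_kernel|exact: measure_ge0|].
  rewrite preimage_setT setTI; under eq_integral do rewrite prob_kernel.
  by rewrite integral_cst ?mul1e//; exact: preimage_measurable.
- move=> B mB [_ _ BP]; split=> [|z|C mC]; [|exact: measure_ge0|].
    by apply: measurable_kernel; exact: measurableC.
  have mZC := preimage_measurable mZ mC; have mVB := preimage_measurable mV mB.
  have fin : P (V @^-1` B `&` Z @^-1` C) \is a fin_num.
    by apply: fin_num_measure; exact: measurableI.
  (* Adding the finite mass of the event of [B] to both sides reduces the complement to the whole
     space. *)
  rewrite -[LHS](addeK _ fin) -[RHS](addeK _ fin); congr (_ - _).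
  rewrite -measureU//; last 3 first.
  + by apply: measurableI => //; apply: preimage_measurable => //; exact: measurableC.
  + exact: measurableI.
  + by apply/seteqP; split => // w [[/= nB _] [? _]].
  rewrite BP// -ge0_integralD//; last 2 first.
  + exact: mk (measurableC mB).
  + exact: mk.
  rewrite -setIUl preimage_setC setUC setUv setTI.
  rewrite (eq_integral (cst 1)) ?integral_cst ?mul1e// => w _.
  rewrite preimage_id -measureU ?setICl//; last exact: measurableC.
  by rewrite setUC setUv; exact: prob_kernel.
- move=> F mF tF FP; split=> [|z|C mC]; [|exact: measure_ge0|].
    by apply: measurable_kernel; exact: bigcupT_measurable.
  have mZC := preimage_measurable mZ mC.
  have mF' n : measurable (V @^-1` F n `&` Z @^-1` C).
    by apply: measurableI => //; exact: preimage_measurable.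
  rewrite preimage_bigcup setI_bigcupl measure_semi_bigcup//; first last.
  + exact: bigcupT_measurable.
  + by move=> i j _ _ [w [[/= Fi _] [Fj _]]]; apply: tF => //; exists (V w).
  rewrite (eq_integral (fun w => \sum_(n <oo) kappa (Z w) (F n))); last first.
    by move=> w _; rewrite measure_semi_bigcup//; exact: bigcupT_measurable.
  rewrite integral_nneseries//; last by move=> n; exact: mk.
  by apply: eq_eseriesr => n _; have [_ _] := FP n; exact.
Qed.

(** If [g] is a version for the difference of the two events, then [f + g] and [f'] have the same
    integral over every event of [Z], hence agree almost everywhere, and [g] is nonnegative. *)
Lemma cond_prob_subset_ae (A A' : set Om) (f f' : S -> R) :
  measurable A -> measurable A' -> A `<=` A' ->
  (forall s, 0 <= f' s <= 1)%R ->
  cond_prob P Z A (EFin \o f) -> cond_prob P Z A' (EFin \o f') ->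
  {ae distribution P (mfun_Sub (mem_set mZ)), forall s, (f s <= f' s)%R}.
Proof.
move=> mA mA' AA' f'01 [mf f0 fP] [mf' f'0 f'P].
have [g [mg g01 [_ g0 gP]]] := cond_prob_exists P mZ (measurableD mA' mA).
have push := ge0_integral_law P mZ.
have : ae_eq (distribution P (mfun_Sub (mem_set mZ))) setT (EFin \o f')
    (fun s => (f s)%:E + (g s)%:E).
  have mfg : measurable_fun setT (fun s => (f s)%:E + (g s)%:E).
    apply: emeasurable_funD; first exact: mf.
    exact/measurable_EFinP.
  apply: integral_ae_eq => //.
    apply: (le_integrable measurableT (g := EFin \o cst 1%R)) => //; last first.
      exact: finite_measure_integrable_cst.
    move=> s _ /=; have /andP[? ?] := f'01 s.
    by rewrite ger0_norm// normr1 lee_fin.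
  move=> C _ mC; rewrite push// push//; last first.
    by move=> s; apply: adde_ge0; [exact: f0|exact: g0].
  rewrite -f'P// ge0_integralD//.
  - rewrite -fP// -gP// -measureU.
    + rewrite -setIUl; congr (P (_ `&` _)); by rewrite setDUK.
    + exact: measurableI _ _ (preimage_measurable mZ mC).
    + exact: measurableI _ _ (measurableD mA' mA) (preimage_measurable mZ mC).
    + by apply/seteqP; split => // w [[? _] [[_]]].
  - exact: preimage_measurable.
  - by move=> w _; exact: f0.
  - by apply/measurable_funTS/(measurableT_comp (f := EFin \o f)).
  - by move=> w _; exact: g0.
  - by apply/measurable_funTS/measurable_EFinP/measurableT_comp.
apply: filterS => s /(_ Logic.I) /= /eqP; rewrite -EFinD eqe => /eqP ->.
by rewrite lerDl; have /andP[] := g01 s.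
Qed.


(* The kernel is s |-> law of h(s, t) for t uniform on [0, 1], where h(s, .) is
   the quantile function of the conditional distribution function along the
   rationals; it needs no modification on a null set. *)
Lemma cond_law_ereal_exists (V : Om -> \bar R) : measurable_fun setT V ->
  exists h : S * measurableTypeR R -> \bar R,
    exists mh : measurable_fun setT h, cond_law P Z V (rand_kernel mh).
Proof.
move=> mV.
have mVlt (r : R) : measurable (V @^-1` `]-oo, r%:E[).
  by apply: preimage_measurable => //; exact: emeasurable_itv.
(* [F r] is a version of P(V < r | Z) for every real [r]: rational levels define the kernel, the
   remaining ones serve in its verification. *)
have [F FP] := choice (fun r => cond_prob_exists P mZ (mVlt r)).
(* An enumeration of the rationals; numbers that code none get the level 0, itself rational. *)
pose q n : R := if choice.unpickle n is Some r then ratr r else 0%R.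
have q_dense (a b : R) : (a < b)%R -> exists n, (a < q n < b)%R.
  move=> ab; have [r] := rat_in_itvoo ab; rewrite in_itv/= => rab.
  by exists (choice.pickle r); rewrite /q choice.pickleK.
(* Levels that fail the test contribute [+oo], so the infimum [h (s, t)] below runs over the
   rational levels [q] with [t < F q s]. *)
pose e n (st : S * measurableTypeR R) : \bar R :=
  if (st.2 < F (q n) st.1)%R then (q n)%:E else +oo.
pose h st := einfs (e ^~ st) 0%N.
have h_lt s t (r : R) :
    h (s, t) < r%:E <-> exists2 n, (q n < r)%R & (t < F (q n) s)%R.
  rewrite /h /einfs/=; split => [/ereal_inf_ltP[_ [n _ <-]]|[n qr tF]].
    by rewrite /e/=; case: ifPn => // tF; rewrite lte_fin; exists n.
  apply/ereal_inf_ltP; exists (q n)%:E; last by rewrite lte_fin.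
  by exists n => //; rewrite /e/= tF.
have mh : measurable_fun setT h.
  apply: measurable_fun_einfs => n; apply: measurable_fun_ifT => //.
  apply: measurable_fun_ltr => //.
  by apply: measurableT_comp => //; have [] := FP (q n).
exists h, mh.
pose mG := @ErealGenInftyO.measurableE R.
apply: (cond_law_generated mV mG).
  move=> _ _ [r ->] [r' ->]; exists (Num.min r r').
  by apply/seteqP; split => y /=; rewrite !in_itv/= EFin_min lt_min => /andP.
move=> _ [r ->]; split; [|by move=> z; exact: measure_ge0|].
  by apply: measurable_kernel; exact: emeasurable_itv.
move=> C mC.
have kE s : rand_kernel mh s `]-oo, r%:E[%classic =
    uniform_prob (@ltr01 R) [set t | exists2 n, (q n < r)%R & (t < F (q n) s)%R].
  rewrite rand_kernelE; congr (uniform_prob _ _); apply/seteqP; split => t /=.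
    by rewrite in_itv/=; exact: (h_lt s t r).1.
  by rewrite in_itv/=; exact: (h_lt s t r).2.
have ltF s a : (forall n, (q n < r)%R -> (F (q n) s <= a)%R) ->
    [set t | exists2 n, (q n < r)%R & (t < F (q n) s)%R] `<=` [set t | (t < a)%R].
  by move=> Fa t [n qr tF]; exact: lt_le_trans (Fa _ qr).
have mlt x : measurable ([set t | (t < x)%R] : set (measurableTypeR R)).
  by rewrite (_ : mkset _ = `]-oo, x[%classic)//; exact: measurable_itv.
have mlts s : measurable ([set t | exists2 n, (q n < r)%R & (t < F (q n) s)%R]
    : set (measurableTypeR R)).
  rewrite (_ : mkset _ = \bigcup_(n in [set n | (q n < r)%R])
    [set t | (t < F (q n) s)%R])//.
  by apply: bigcup_measurable => n _; exact: mlt.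
have mkr : measurable_fun setT (fun s => rand_kernel mh s `]-oo, r%:E[%classic).
  by apply: measurable_kernel; exact: emeasurable_itv.
have [mFr F01r Fr] := FP r.
apply/eqP; rewrite eq_le; apply/andP; split; last first.
- have [_ _ ->] := Fr => //.
  have [_ F0r _] := Fr.
  rewrite -(ge0_integral_law P mZ (k := EFin \o F r))//; last exact/measurable_EFinP.
  rewrite -(ge0_integral_law P mZ
    (k := fun s => rand_kernel mh s `]-oo, r%:E[%classic))//.
  apply: ae_ge0_le_integral => //; do ?[exact: measurable_funTS].
    exact/measurable_funTS/measurable_EFinP.
  (* Versions are monotone in the level only almost everywhere; since the levels [q n] are
     countable, one null set covers them all. *)
  have : {ae distribution P (mfun_Sub (mem_set mZ)), forall s,
      forall n, (q n < r)%R -> (F (q n) s <= F r s)%R}.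
    apply: ae_foralln => n; have [qr|qr] := ltP (q n) r; last exact: aeW.
    have [_ _ Fn] := FP (q n).
    have VnVr : V @^-1` `]-oo, (q n)%:E[ `<=` V @^-1` `]-oo, r%:E[.
      by move=> w /=; rewrite !in_itv/= => Vq; apply: lt_trans Vq _; rewrite lte_fin.
    apply: filterS (cond_prob_subset_ae (mVlt _) (mVlt _) VnVr F01r Fn Fr) => s.
    by move=> ? _.
  apply: filterS => s Fs _; rewrite kE /= -(uniform01_lt (F01r s)); apply: le_measure.
  + by rewrite inE; exact: mlts.
  + by rewrite inE; exact: mlt.
  + by apply: ltF => n; exact: Fs.
have mZC := preimage_measurable mZ mC.
(* For the converse inequality, levels strictly below [r] leave room for a rational level between
   [a m] and [r]. There [F] is below the kernel at every point, with no exceptional set. *)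
pose a m := (r - m.+1%:R^-1)%R.
have cvgP : P (V @^-1` `]-oo, (a m)%:E[ `&` Z @^-1` C) @[m --> \oo] -->
    P (V @^-1` `]-oo, r%:E[ `&` Z @^-1` C).
  rewrite [X in _ --> P X](_ : _ =
      \bigcup_m (V @^-1` `]-oo, (a m)%:E[ `&` Z @^-1` C)).
    apply: nondecreasing_cvg_mu.
    - by move=> m; exact: measurableI.
    - by apply: bigcupT_measurable => m; exact: measurableI.
    - move=> m m' mm'; apply/subsetPset => w [/=]; rewrite !in_itv/= => Va ZC.
      split => //; apply: lt_le_trans Va _; rewrite lee_fin lerB// lef_pV2 ?posrE//.
      by rewrite ler_nat.
  apply/seteqP; split => w /=; rewrite !in_itv/=.
    move=> [Vr ZC]; case VwE : (V w) Vr => [y| |] //.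
    - rewrite lte_fin => /ltr_add_invr[m ym]; exists m => //=; split => //.
      by rewrite /= in_itv/= VwE lte_fin ltrBrDr.
    - by move=> _; exists 0%N => //=; split => //; rewrite /= in_itv/= VwE ltNyr.
  move=> [m _ [/=]]; rewrite in_itv/= => Va ZC; split => //; apply: lt_trans Va _.
  by rewrite lte_fin ltrBlDr ltrDl invr_gt0.
rewrite -(cvg_lim _ cvgP)//; apply: lime_le; first by apply/cvg_ex; eexists; exact: cvgP.
apply: nearW => m.
have [n /andP[an nr]] : exists n, (a m < q n < r)%R.
  by apply: q_dense; rewrite ltrBlDr ltrDl invr_gt0.
have [mFn F01n [_ _ Fn]] := FP (q n).
apply: (@le_trans _ _ (P (V @^-1` `]-oo, (q n)%:E[ `&` Z @^-1` C))).
  apply: le_measure; rewrite ?inE//; [exact: measurableI..|].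
  move=> w [/=]; rewrite !in_itv/= => Va ZC; split => //.
  by apply: lt_trans Va _; rewrite lte_fin.
rewrite Fn//; apply: ge0_le_integral => //.
- by move=> w _; have /andP[] := F01n (Z w); rewrite lee_fin.
- by apply/measurable_funTS/measurable_EFinP/measurableT_comp.
- by apply/measurable_funTS/(measurableT_comp mkr).
- move=> w _; rewrite kE /= -(uniform01_lt (F01n (Z w))); apply: le_measure.
  + by rewrite inE; exact: mlt.
  + by rewrite inE; exact: mlts.
  + by move=> t tF; exists n.
Qed.

End ConditionalLaw.

(** A measurable retract of the extended reals inherits conditional laws: the kernel for [i \o U] is
    pushed forward along [r], which undoes [i]. *)
Lemma cond_law_exists d (Om : measurableType d) (R : realType)
    (P : probability Om R) d1 d2 (S : measurableType d1) (T : measurableType d2)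
    (Z : Om -> S) (U : Om -> T) (i : T -> \bar R) (r : \bar R -> T) :
  measurable_fun setT Z -> measurable_fun setT U -> measurable_fun setT i ->
  measurable_fun setT r -> cancel i r ->
  exists kappa : R.-pker S ~> T, cond_law P Z U kappa.
Proof.
move=> mZ mU mi mr irK.
have [h [mh hP]] := cond_law_ereal_exists P mZ (measurableT_comp mi mU).
exists (rand_kernel (measurableT_comp mr mh)) => B mB.
have := hP _ (preimage_measurable mr mB).
by rewrite (_ : (i \o U) @^-1` _ = U @^-1` B)//; apply/seteqP; split => w /=; rewrite irK.
Qed.

(** * Borel retraction onto a compact subset of the line *)

Section Borel.
Variable R : realType.

Lemma continuous_borel_real (T : ptopologicalType) (f : T -> R) :
  continuous f -> measurable_fun setT (f : borel T -> R).
Proof.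
move=> /continuousP cf; apply: (measurability _ (RGenOpens.measurableE R)) => //.
move=> _ [_ [a [b ->]] <-]; rewrite setTI; apply: sub_sigma_algebra.
by apply: cf; exact: interval_open.
Qed.

Variable X : polishType R.

Lemma continuous_isometry (f : X -> R) :
  (forall x y, mdist x y = `|f x - f y|) -> continuous f.
Proof.
move=> fd x; apply/cvgrPdist_lt => e e0; near=> y; rewrite -fd.
have : ball x e y by near: y; exact: nbhsx_ballx.
by rewrite ballEmdist.
Unshelve. all: by end_near. Qed.

(** The left inverse sends everything off the range to [point]. It is Borel because the range is
    compact, hence closed, and [f] maps open sets to relatively open subsets of the range. *)
Lemma isometry_retract (f : X -> R) : compact (range f) ->
  (forall x y, mdist x y = `|f x - f y|) ->
  exists2 r : \bar R -> borel X, measurable_fun setT r &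
    cancel (EFin \o f) r.
Proof.
move=> fc fd.
have finj x y : f x = f y -> x = y.
  by move=> fxy; apply: (@mdist_positivity R X); rewrite fd fxy subrr normr0.
pose r y := xget (point : X) [set x | (f x)%:E = y].
have rK : cancel (EFin \o f) r.
  move=> x; have : (f (r (f x)%:E))%:E = (f x)%:E.
    by apply: (xgetPex _ (P := [set z | (f z)%:E = (f x)%:E])); exists x.
  by case=> /finj.
exists r => //.
apply: (@measurability _ _ _ (borel X) _ _ (@open X)) => //.
move=> _ [A oA <-]; rewrite setTI.
(* An open subset of the line whose trace on the range is the image of [A]: as [f] is an isometry,
   the ball around [f x] pulls back to the ball of the same radius around [x]. *)
pose W := \bigcup_(p in [set p : X * R | 0 < p.2 /\ ball p.1 p.2 `<=` A])
  ball (f p.1) p.2.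
have mrange : measurable (range f).
  by apply: closed_measurable; apply: compact_closed => //; exact: norm_hausdorff.
have mW : measurable W.
  apply: open_measurable; apply: bigcup_open => -[x e] [/= e0 _].
  exact: ball_open.
have fA : f @` A = range f `&` W.
  apply/seteqP; split => [_ [x Ox <-]|_ [[x _ <-] [[y e] /= [e0 yO]]]].
    split; first by exists x.
    have /nbhs_ballP[e e0 xO] : nbhs x A by exact: open_nbhs_nbhs.
    by exists (x, e) => //; exact: ballxx.
  move=> yx; exists x => //; apply: yO; rewrite ballEmdist/= fd.
  by rewrite distrC; move: yx; rewrite -ball_normE/= distrC.
have mfA : measurable (EFin @` (f @` A)).
  by apply: measurable_image_EFin; rewrite fA; exact: measurableI.
have mfT : measurable (EFin @` range f) by exact: measurable_image_EFin.
rewrite (_ : r @^-1` A = (EFin @` (f @` A)) `|`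
  ((~` (EFin @` range f)) `&` [set _ | A point])).
  apply: measurableU => //; apply: measurableI; first exact: measurableC.
  have [Op|nOp] := pselect (A point).
    by rewrite (_ : mkset _ = setT)//; apply/seteqP; split.
  by rewrite (_ : mkset _ = set0)//; apply/seteqP; split.
apply/seteqP; split => [y Oy|y].
  have [[_ [x _ <-] fxy]|ny] := pselect ((EFin @` range f) y).
    by left; exists (f x) => //; exists x => //; move: Oy; rewrite /= -fxy rK.
  right; split => //=; rewrite -(_ : r y = point)//.
  rewrite /r xgetPN// => x fxy; apply: ny; exists (f x) => //; exists x => //.
move=> [[_ [x Ox <-] <-]|[ny Op]] /=; first by rewrite rK.
by rewrite /r xgetPN// => x fxy; apply: ny; exists (f x) => //; exists x.
Qed.


End Borel.

(** * Causal couplings *)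

Lemma connect_rank (V : finType) (e : rel V) (rank : V -> nat) :
  (forall s t, e s t -> (rank s <= rank t)%N) ->
  forall s t, connect e s t -> (rank s <= rank t)%N.
Proof.
move=> er s t /connectP[p]; elim: p s => [s _ -> //|u p ih s /= /andP[esu up] tE].
by apply: leq_trans (er _ _ esu) _; exact: ih.
Qed.

Lemma dsc_rank (V : finType) (e : rel V) (rank : V -> nat) (s t : V) :
  (forall s t, e s t -> (rank s <= rank t)%N) ->
  t \in dsc e s -> (rank s <= rank t)%N.
Proof.
move=> er; rewrite !finset.inE => /existsP[u /andP[/er su /(connect_rank er)]].
exact: leq_trans.
Qed.

Section ProductTopology.

Lemma continuous_to_product (T : topologicalType) (V : Type)
    (X : V -> ptopologicalType) (f : T -> prod_topology X) :
  (forall v, continuous (fun x => f x v)) -> continuous f.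
Proof.
move=> fc x; apply/cvg_sup => v; move: x.
apply/(@continuousP _ (initial_topology (@^~ v))) => _ [B oB <-].
rewrite -comp_preimage; move/continuousP : (fc v); exact.
Qed.

Context (R : realType) (V : finType) (X : V -> polishType R) (A : {set V}).

(** A section of the restriction map, with [point] in the missing coordinates. Through it an event
    determined by the coordinates in [A] becomes an event of the restricted vector, the form that
    [cond_indep] asks for. *)
Definition extend (w : product_on X A) : product_space X := fun v =>
  if pselect (v \in A) is left vA then w (exist _ v vA) else point.

Lemma extendE (Om : Type) (Z : forall v, Om -> X v) (w : Om) (v : V) :
  v \in A -> extend (joint Z A w) v = Z v w.
Proof. by move=> vA; rewrite /extend; case: pselect. Qed.

Lemma continuous_extend : continuous extend.
Proof.
apply: continuous_to_product => v; rewrite /extend.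
case: pselect => [vA|_]; last by move=> ?; exact: cst_continuous.
exact: (@proj_continuous _ (fun u : {v | v \in A} => X (val u) : ptopologicalType)
  (exist _ v vA)).
Qed.

End ProductTopology.

Section PairSpace.
Context (R : realType) (V : finType) (X Y : V -> polishType R).

Lemma continuous_pair_proj s :
  continuous (@pair_proj R V X Y s : pair_space X Y -> sum_family X Y s).
Proof.
case: s => i z; rewrite /pair_proj.
- apply: (@continuous_comp (pair_space X Y) (product_space X) (X i) fst (@^~ i)).
    exact: cvg_fst.
  exact: (@proj_continuous V (fun u => X u : ptopologicalType)).
- apply: (@continuous_comp (pair_space X Y) (product_space Y) (Y i) snd (@^~ i)).
    exact: cvg_snd.
  exact: (@proj_continuous V (fun u => Y u : ptopologicalType)).
Qed.

Lemma continuous_joint_pair_proj (A : {set V + V}) :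
  continuous (joint (@pair_proj R V X Y) A :
    pair_space X Y -> product_on (sum_family X Y) A).
Proof.
by apply: continuous_to_product => -[s sA]; exact: continuous_pair_proj.
Qed.

Definition unsum (f : product_space (sum_family X Y)) : pair_space X Y :=
  (fun i => f (inl i), fun i => f (inr i)).

Lemma continuous_unsum : continuous unsum.
Proof.
have c s := @proj_continuous _ (fun s => sum_family X Y s : ptopologicalType) s.
have c1 : continuous (fun f => (unsum f).1 : product_space X).
  apply: (continuous_to_product (X := fun i => X i : ptopologicalType)) => i.
  exact: (c (inl i)).
have c2 : continuous (fun f => (unsum f).2 : product_space Y).
  apply: (continuous_to_product (X := fun i => Y i : ptopologicalType)) => i.
  exact: (c (inr i)).
by move=> f; exact: (cvg_pair (c1 f) (c2 f)).
Qed.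

End PairSpace.

Lemma sorted_dag_dsc (n : nat) (E : rel 'I_n) (i j : 'I_n) :
  sorted_dag E -> (i < j)%N -> i \in ~: (dsc E j :|: [set j]%SET).
Proof.
move=> [_ sE] ij; rewrite finset.in_setC finset.in_setU finset.in_set1 negb_or.
apply/andP; split; last first.
  by rewrite neq_ltn ij.
apply: contraL ij => ijE; rewrite -leqNgt.
apply: (dsc_rank (rank := val)) ijE => s t st.
by apply: ltnW; apply: sE; rewrite finset.inE.
Qed.

(** A rank for the causal graph: both copies of a vertex share it, so it is only weakly increasing,
    constant along the edges from i to i'. *)
Definition vertex_index (n : nat) (s : 'I_n + 'I_n) : nat :=
  match s with inl i => i | inr i => i end.

(** This brings the past of both marginals, not only of the first, into the nondescendants of the
    vertex [inl j]. *)
Lemma causal_graph_dsc (n : nat) (E : rel 'I_n) (s : 'I_n + 'I_n) (j : 'I_n) :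
  sorted_dag E -> (vertex_index s < j)%N ->
  s \in ~: (dsc (causal_graph E) (inl j) :|: [set inl j]%SET).
Proof.
move=> [_ sE] sj; rewrite finset.in_setC finset.in_setU finset.in_set1 negb_or.
apply/andP; split; last first.
  by apply: contraL sj => /eqP ->; rewrite ltnn.
apply: contraL sj => sjE; rewrite -leqNgt.
apply: (dsc_rank (rank := @vertex_index n)) sjE => u v.
have lt i l : E i l -> (i <= l)%N.
  by move=> il; apply: ltnW; apply: sE; rewrite finset.inE.
case: u v => [i|i] [l|l] //=; try exact: lt.
by case/orP => [/lt//|/eqP ->].
Qed.

Section CausalCoupling.
Local Open Scope ereal_scope.
Context (R : realType) (n : nat) (X : 'I_n -> polishType R) (E E' : rel 'I_n).
Variable j : 'I_n.
Hypotheses (sE : sorted_dag E) (sE' : sorted_dag E') (EE' : subrel E E').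

Lemma measurable_coord (i : 'I_n) :
  measurable_fun setT (@Defs.coord R 'I_n X i : _ -> borel (X i)).
Proof.
apply: (@continuous_borel (product_space X) (X i)).
exact: (@proj_continuous _ (fun u => X u : ptopologicalType)).
Qed.

Variables mu nu : probability (borel (product_space X)) R.
Hypothesis cmu : compatible_measures E mu.
Variables (A : set (borel (X j))) (f : borel (product_on X (pa E j)) -> \bar R).
Hypotheses (mA : measurable A)
  (fP : cond_prob mu (restr (pa E j)) (@Defs.coord R _ X j @^-1` A) f).

(** In a sorted graph all coordinates before [j] are nondescendants of [j], so [D] is an event of
    the vector from which X_j is conditionally independent. *)
Lemma compatible_cond_prob (D : set (borel (product_space X))) :
  measurable D ->
  (forall x x' : product_space X,
     (forall i : 'I_n, (i < j)%N -> x i = x' i) -> D x -> D x') ->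
  mu ((@Defs.coord R _ X j @^-1` A) `&` D) =
  \int[mu]_(x in D) f (restr (pa E j) x).
Proof.
move=> mD Dj.
pose nd := ~: (dsc E j :|: [set j]%SET).
pose W : _ -> borel (product_on X nd) := @restr R 'I_n X nd.
(* [D] ignores every coordinate that [extend] fills with a default, so [B] pulls back to [D]. *)
pose B : set (borel (product_on X nd)) := (@extend R 'I_n X nd) @^-1` D.
have mB : measurable B.
  by apply: preimage_measurable mD; apply: continuous_borel; exact: continuous_extend.
have WB : W @^-1` B = D.
  have ext x (i : 'I_n) : (i < j)%N -> extend (W x) i = x i.
    move=> ij; rewrite /W /restr (extendE (@Defs.coord R 'I_n X))//.
    exact: sorted_dag_dsc.
  by apply/seteqP; split => x; apply: Dj => i /ext.
rewrite -WB; have indep := (cmu : compatible E mu (@Defs.coord R _ X)) j.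
apply: (cond_indep_cond_prob _ _ _ indep) => //.
- exact: continuous_borel (@continuous_restr R _ X (pa E j)).
- exact: measurable_coord.
- exact: continuous_borel (@continuous_restr R _ X nd).
Qed.

Variable pi : probability (borel (pair_space X X)) R.
Hypothesis cpi : causal_couplings E' mu nu pi.

Lemma measurable_fst_pair :
  measurable_fun setT (fst : borel (pair_space X X) -> borel (product_space X)).
Proof. by apply: (@continuous_borel (pair_space X X)) => z; exact: cvg_fst. Qed.

Lemma coupling_integral_fst (D : set (borel (product_space X)))
    (g : borel (product_space X) -> \bar R) :
  measurable D -> measurable_fun setT g -> (forall x, 0 <= g x) ->
  \int[mu]_(x in D) g x = \int[pi]_(z in [set z | D z.1]) g z.1.
Proof.
move=> mD mg g0; have [[pi1 _] _] := cpi.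
rewrite -(ge0_integral_law pi measurable_fst_pair)//.
by apply: eq_measure_integral => C mC _; exact: (esym (pi1 C mC)).
Qed.

(** Compatibility of [mu] with the small graph [E] shows that [f] remains a version given the larger
    parent set in [E']; causality of [pi] for [E'] then admits events of the past of both
    marginals. *)
Lemma causal_cond_prob (D : set (borel (pair_space X X))) :
  measurable D ->
  (forall z z' : pair_space X X, (forall i : 'I_n, (i < j)%N ->
     z.1 i = z'.1 i /\ z.2 i = z'.2 i) -> D z -> D z') ->
  pi ([set z | A (z.1 j)] `&` D) = \int[pi]_(z in D) f (restr (pa E j) z.1).
Proof.
move=> mD Dj; have [mf f0 _] := fP; have [[pi1 _] cpi'] := cpi.
pose H := causal_graph E'.
pose nd : {set 'I_n + 'I_n} := ~: (dsc H (inl j) :|: [set inl j]%SET).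
pose pp : {set 'I_n + 'I_n} := pa H (inl j).
pose proj := @pair_proj R 'I_n X X.
pose W : _ -> borel (product_on (sum_family X X) nd) := joint proj nd.
pose Z : _ -> borel (product_on (sum_family X X) pp) := joint proj pp.
pose ext (K : {set 'I_n + 'I_n}) : borel (product_on (sum_family X X) K) ->
  borel (pair_space X X) := fun w => unsum (extend w).
have mext K : measurable_fun setT (ext K).
  apply: (@continuous_borel (product_on (sum_family X X) K) (pair_space X X)) => w.
  apply: (continuous_comp (f := @extend _ _ (sum_family X X) K)).
    exact: continuous_extend.
  exact: continuous_unsum.
have mjoint K : measurable_fun setT
    (joint proj K : _ -> borel (product_on (sum_family X X) K)).
  exact: continuous_borel (@continuous_joint_pair_proj R _ X X K).
have ext1 (K : {set 'I_n + 'I_n}) (z : pair_space X X) (i : 'I_n) :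
    inl i \in K -> (ext K (joint proj K z)).1 i = z.1 i.
  by move=> iK; rewrite /ext/= (extendE proj).
have ext2 (K : {set 'I_n + 'I_n}) (z : pair_space X X) (i : 'I_n) :
    inr i \in K -> (ext K (joint proj K z)).2 i = z.2 i.
  by move=> iK; rewrite /ext/= (extendE proj).
have ppP s : s \in pp -> exists2 i : 'I_n, s = inl i & (i < j)%N.
  rewrite finset.inE /H; case: s => //= i E'ij; exists i => //.
  by apply: sE'.2; rewrite finset.inE.
have pa_pp i : i \in pa E j -> inl i \in pp.
  by rewrite !finset.inE => /EE'.
pose fZ (w : borel (product_on (sum_family X X) pp)) := f (restr (pa E j) (ext pp w).1).
have fZE z : fZ (Z z) = f (restr (pa E j) z.1).
  rewrite /fZ; congr f; apply/functional_extensionality_dep => -[i iE] /=.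
  by apply: ext1; exact: pa_pp.
have mrestr : measurable_fun setT (@restr R 'I_n X (pa E j)).
  exact: continuous_borel (@continuous_restr R _ X (pa E j)).
(* A test event on the [E']-parents concerns coordinates of the first marginal before [j] alone, so
   it can be evaluated under [mu]. *)
have fZP : cond_prob pi Z (proj (inl j) @^-1` A) fZ.
  split.
  - apply: (measurableT_comp mf); apply: (measurableT_comp mrestr).
    exact: (measurableT_comp measurable_fst_pair (mext pp)).
  - by move=> w; exact: f0.
  move=> C mC.
  (* The parents of [inl j] are all of the form [inl i], so the second component may be any
     dummy. *)
  pose Zx (x : borel (product_space X)) := Z (x, point).
  have ZE z : Z z = Zx z.1.
    apply/functional_extensionality_dep => -[s spp] /=.
    by have [i si _] := ppP _ spp; subst s.
  have mpt : measurable_fun setT (fun x : borel (product_space X) =>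
      ((x, point) : borel (pair_space X X))).
    apply: (@continuous_borel (product_space X) (pair_space X X)) => x.
    exact: (@cvg_pair _ _ _ (nbhs x) (nbhs x) (nbhs (point : product_space X))
      _ _ _ id (cst point) cvg_id (cvg_cst _)).
  pose DX := Zx @^-1` C.
  have mDX : measurable DX.
    exact: preimage_measurable (measurableT_comp (mjoint pp) mpt) mC.
  have ZC : Z @^-1` C = [set z | DX z.1].
    by apply/seteqP; split => z; rewrite /DX/= ZE.
  rewrite ZC (_ : _ `&` _ = [set z | ((@Defs.coord R _ X j @^-1` A) `&` DX) z.1])//.
  rewrite pi1; last first.
    by apply: measurableI => //; exact: preimage_measurable (@measurable_coord j) mA.
  rewrite compatible_cond_prob//; last first.
    move=> x x' xx'; rewrite /DX/= (_ : Zx x = Zx x')//.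
    apply/functional_extensionality_dep => -[s spp] /=.
    by have [i si ij] := ppP _ spp; subst s; exact: xx'.
  rewrite coupling_integral_fst//; last exact: measurableT_comp mrestr.
  by apply: eq_integral => z _; rewrite fZE.
have indep := (cpi' : compatible H pi proj) (inl j).
pose B : set (borel (product_on (sum_family X X) nd)) := ext nd @^-1` D.
have mB : measurable B by exact: preimage_measurable mD.
have WB : W @^-1` B = D.
  have ext12 z (i : 'I_n) : (i < j)%N ->
      (ext nd (W z)).1 i = z.1 i /\ (ext nd (W z)).2 i = z.2 i.
    by move=> ij; split; [apply: ext1|apply: ext2]; exact: causal_graph_dsc.
  apply/seteqP; split => z; apply: Dj => i ij; have [e1 e2] := ext12 z i ij.
    by rewrite e1 e2.
  by rewrite e1 e2.
rewrite -WB; under eq_integral do rewrite -fZE.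
apply: (cond_indep_cond_prob _ _ _ indep) => //; do ?exact: mjoint.
exact: continuous_borel (@continuous_pair_proj R _ X X (inl j)).
Qed.

End CausalCoupling.

(** * Comparison of mean distances by two test events *)

Section Bounded.
Local Open Scope ereal_scope.
Context d (Om : measurableType d) (R : realType) (P : probability Om R).

Lemma ge0_bounded_integrable (f : Om -> R) (M : R) (D : set Om) :
  measurable D -> measurable_fun setT f -> (forall w, 0 <= f w <= M)%R ->
  P.-integrable D (EFin \o f).
Proof.
move=> mD mf fM.
apply: (le_integrable mD (g := EFin \o cst M)) => //.
- exact/measurable_funTS/measurable_EFinP.
- move=> w _ /=; have /andP[f0 fwM] := fM w.
  by rewrite lee_fin !ger0_norm// (le_trans f0).
- exact: finite_measure_integrable_cst.
Qed.

(** On {g < f} the distance |f - g| is f - g, whose integral equals that of u - v and so is at most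
    that of |u - v|; on the complement the roles are exchanged. This is the contraction property of
    conditional expectation in L1. The bound [M] makes the differences integrable. *)
Lemma le_integral_dist (f g u v : Om -> R) (M : R) :
  measurable_fun setT f -> measurable_fun setT g ->
  measurable_fun setT u -> measurable_fun setT v ->
  (forall w, 0 <= f w <= M)%R -> (forall w, 0 <= g w <= M)%R ->
  (forall w, 0 <= u w <= M)%R -> (forall w, 0 <= v w <= M)%R ->
  (forall D, D = [set w | (g w < f w)%R] \/ D = ~` [set w | (g w < f w)%R] ->
     \int[P]_(w in D) (f w)%:E = \int[P]_(w in D) (u w)%:E /\
     \int[P]_(w in D) (g w)%:E = \int[P]_(w in D) (v w)%:E) ->
  \int[P]_w `|f w - g w|%:E <= \int[P]_w `|u w - v w|%:E.
Proof.
move=> mf mg mu mv fM gM uM vM DE.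
pose D := [set w | (g w < f w)%R].
have mD : measurable D.
  exact: (preimage_measurable (C := [set true]) (measurable_fun_ltr mg mf)).
have mDC := measurableC mD.
have split_abs (p q : Om -> R) : measurable_fun setT p -> measurable_fun setT q ->
    \int[P]_w `|p w - q w|%:E = \int[P]_(w in D) `|p w - q w|%:E +
      \int[P]_(w in ~` D) `|p w - q w|%:E.
  move=> mp mq; rewrite -ge0_integral_setU ?setUv//.
  - by apply/measurable_EFinP; apply: measurableT_comp => //; exact: measurable_funB.
  - by rewrite disj_set2E setICr.
rewrite split_abs// [leRHS]split_abs//.
have int (h : Om -> R) C : measurable C -> measurable_fun setT h ->
  (forall w, 0 <= h w <= M)%R -> P.-integrable C (EFin \o h).
  exact: ge0_bounded_integrable.
have step C (f' g' u' v' : Om -> R) : measurable C ->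
  measurable_fun setT f' -> measurable_fun setT g' ->
  measurable_fun setT u' -> measurable_fun setT v' ->
  (forall w, 0 <= f' w <= M)%R -> (forall w, 0 <= g' w <= M)%R ->
  (forall w, 0 <= u' w <= M)%R -> (forall w, 0 <= v' w <= M)%R ->
  (forall w, C w -> (g' w <= f' w)%R) ->
  \int[P]_(w in C) (f' w)%:E = \int[P]_(w in C) (u' w)%:E ->
  \int[P]_(w in C) (g' w)%:E = \int[P]_(w in C) (v' w)%:E ->
  \int[P]_(w in C) `|f' w - g' w|%:E <= \int[P]_(w in C) `|u' w - v' w|%:E.
  move=> mC mf' mg' mu' mv' f'M g'M u'M v'M gf fu gv.
  rewrite (eq_integral (fun w => (f' w)%:E - (g' w)%:E)); last first.
    by move=> w; rewrite inE => /gf gfw; rewrite ger0_norm ?subr_ge0// EFinB.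
  rewrite integralB_EFin//; [|exact: int..].
  rewrite fu gv -integralB_EFin//; [|exact: int..].
  apply: le_integral => //.
  - by apply: integrableB => //; exact: int.
  - exact: integrable_abse (integrableB mC (int _ _ mC mu' u'M) (int _ _ mC mv' v'M)).
  - by move=> w _; rewrite -EFinB lee_fin ler_norm.
have [fuD gvD] := DE D (or_introl erefl).
have [fuC gvC] := DE (~` D) (or_intror erefl).
apply: leeD.
  by apply: step => // w /ltW.
under eq_integral do rewrite distrC.
under [leRHS]eq_integral do rewrite distrC.
by apply: step => // w /negP; rewrite -leNgt.
Qed.

End Bounded.

Section Propensity.
Local Open Scope ereal_scope.
Context (R : realType) (n : nat) (X : 'I_n -> polishType R) (E E' : rel 'I_n).
Variable j : 'I_n.
Hypotheses (sE : sorted_dag E) (sE' : sorted_dag E') (EE' : subrel E E').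

Lemma measurable_snd_pair :
  measurable_fun setT (snd : borel (pair_space X X) -> borel (product_space X)).
Proof. by apply: (@continuous_borel (pair_space X X)) => z; exact: cvg_snd. Qed.

Lemma measurable_restr (A : {set 'I_n}) :
  measurable_fun setT (@restr R 'I_n X A).
Proof. exact: continuous_borel (@continuous_restr R _ X A). Qed.

Lemma measurable_restr_fst (A : {set 'I_n}) :
  measurable_fun setT (fun z : borel (pair_space X X) => @restr R 'I_n X A z.1).
Proof.
apply: (measurableT_comp (f := @restr R _ X A)
  (g := fst : borel (pair_space X X) -> borel (product_space X))).
  exact: measurable_restr.
exact: measurable_fst_pair.
Qed.

Lemma measurable_restr_snd (A : {set 'I_n}) :
  measurable_fun setT (fun z : borel (pair_space X X) => @restr R 'I_n X A z.2).
Proof.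
apply: (measurableT_comp (f := @restr R _ X A)
  (g := snd : borel (pair_space X X) -> borel (product_space X))).
  exact: measurable_restr.
exact: measurable_snd_pair.
Qed.

(* Under a bicausal coupling both propensities are conditional expectations of
   treatment indicators given the same variables, all coordinates before j. *)
Lemma bicausal_propensity (mu nu : probability (borel (product_space X)) R)
    (pi : probability (borel (pair_space X X)) R) (A : set (borel (X j)))
    (e e' : borel (product_on X (pa E j)) -> R) (M : R) :
  compatible_measures E mu -> compatible_measures E nu ->
  bicausal_couplings E' mu nu pi -> measurable A ->
  (1 <= M)%R -> (forall p, 0 <= e p <= M)%R -> (forall p, 0 <= e' p <= M)%R ->
  cond_prob mu (restr (pa E j)) (@Defs.coord R _ X j @^-1` A) (EFin \o e) ->
  cond_prob nu (restr (pa E j)) (@Defs.coord R _ X j @^-1` A) (EFin \o e') ->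
  \int[pi]_z `|e (restr (pa E j) z.1) - e' (restr (pa E j) z.2)|%:E <=
  \int[pi]_z `|\1_A (z.1 j) - \1_A (z.2 j)|%:E.
Proof.
move=> cmu cnu [cpi acpi] mA M1 eM e'M eP e'P.
have [me _ _] := eP; have [me' _ _] := e'P.
have me1 : measurable_fun setT (fun z : borel (pair_space X X) => e (restr (pa E j) z.1)).
  apply: (measurableT_comp (f := e)); first exact/measurable_EFinP.
  exact: measurable_restr_fst.
have me2 : measurable_fun setT (fun z : borel (pair_space X X) => e' (restr (pa E j) z.2)).
  apply: (measurableT_comp (f := e')); first exact/measurable_EFinP.
  exact: measurable_restr_snd.
have mj1 : measurable_fun setT (fun z : borel (pair_space X X) => z.1 j : borel (X j)).
  apply: (measurableT_comp (f := @Defs.coord R _ X j : _ -> borel (X j))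
    (g := fst : borel (pair_space X X) -> borel (product_space X))).
    exact: measurable_coord.
  exact: measurable_fst_pair.
have mj2 : measurable_fun setT (fun z : borel (pair_space X X) => z.2 j : borel (X j)).
  apply: (measurableT_comp (f := @Defs.coord R _ X j : _ -> borel (X j))
    (g := snd : borel (pair_space X X) -> borel (product_space X))).
    exact: measurable_coord.
  exact: measurable_snd_pair.
have mA1 : measurable [set z : borel (pair_space X X) | A (z.1 j)].
  exact: preimage_measurable mj1 mA.
have mA2 : measurable [set z : borel (pair_space X X) | A (z.2 j)].
  exact: preimage_measurable mj2 mA.
apply: (@le_integral_dist _ (borel (pair_space X X)) R pi
  (fun z => e (restr (pa E j) z.1)) (fun z => e' (restr (pa E j) z.2))
  (fun z => \1_A (z.1 j)) (fun z => \1_A (z.2 j)) M) => //.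
- exact: measurable_indic mA1.
- exact: measurable_indic mA2.
- by move=> z; rewrite indicE; case: (_ \in _); rewrite ?lexx ?ler01 ?M1// (le_trans _ M1).
- by move=> z; rewrite indicE; case: (_ \in _); rewrite ?lexx ?ler01 ?M1// (le_trans _ M1).
(* The test event involves only parents of [j] in both marginals, all of index below [j], so
   [causal_cond_prob] applies to it and to its complement. *)
pose D0 : set (borel (pair_space X X)) :=
  [set z | (e' (restr (pa E j) z.2) < e (restr (pa E j) z.1))%R].
have mD0 : measurable D0.
  exact: (preimage_measurable (C := [set true]) (measurable_fun_ltr me2 me1)).
have D0j z z' : (forall i : 'I_n, (i < j)%N -> z.1 i = z'.1 i /\ z.2 i = z'.2 i) ->
    D0 z = D0 z'.
  move=> zz'; rewrite /D0/=.
  have lt (s : {i | i \in pa E j}) : (val s < j)%N by apply: sE.2; exact: valP.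
  rewrite (_ : restr _ z.1 = restr (pa E j) z'.1); last first.
    by apply/functional_extensionality_dep => s; have [] := zz' _ (lt s).
  rewrite (_ : restr _ z.2 = restr (pa E j) z'.2)//.
  by apply/functional_extensionality_dep => s; have [] := zz' _ (lt s).
move=> D DE.
have mD : measurable D by case: DE => ->; [|exact: measurableC].
have Dj z z' : (forall i : 'I_n, (i < j)%N -> z.1 i = z'.1 i /\ z.2 i = z'.2 i) ->
    D z -> D z'.
  by move=> /D0j; case: DE => -> /=; rewrite /D0/= => ->.
have indicA (B : set (borel (pair_space X X))) : measurable B ->
  \int[pi]_(z in D) (\1_B z)%:E = pi (B `&` D) by exact: integral_indic.
split.
  transitivity (pi ([set z | A (z.1 j)] `&` D)); last by rewrite -indicA.
  by rewrite (causal_cond_prob sE sE' EE' cmu mA eP cpi mD Dj).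
transitivity (pi ([set z | A (z.2 j)] `&` D)); last by rewrite -indicA.
(* The second identity is the first one for [nu] and the swapped coupling, which is causal by
   anticausality of [pi]. *)
pose D' : set (borel (pair_space X X)) := @Defs.swap_pair R _ X X @^-1` D.
have mswap : measurable_fun setT (@Defs.swap_pair R _ X X) by [].
have mD' : measurable D' by exact: preimage_measurable mswap mD.
have D'j z z' : (forall i : 'I_n, (i < j)%N -> z.1 i = z'.1 i /\ z.2 i = z'.2 i) ->
    D' z -> D' z'.
  by move=> zz'; apply: Dj => i /zz'[].
have := causal_cond_prob sE sE' EE' cnu mA e'P acpi mD' D'j.
have D'E : D' = @Defs.swap_pair R _ X X @^-1` D by [].
rewrite (_ : [set z | A (z.1 j)] `&` D' =
  @Defs.swap_pair R _ X X @^-1` ([set z | A (z.2 j)] `&` D))//.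
rewrite /distribution/= /pushforward => piE.
transitivity (\int[distribution pi (@Defs.swap_pair R _ X X)]_(z in D')
  (e' (restr (pa E j) z.1))%:E).
  rewrite ge0_integral_pushforward//; last 2 first.
  - apply/measurable_funTS/(measurableT_comp (f := EFin \o e')) => //.
    exact: measurable_restr_fst.
  - by move=> z _; rewrite lee_fin; have /andP[] := e'M (restr (pa E j) z.1).
  rewrite (_ : _ @^-1` D' = D)//.
  by apply/seteqP; split => -[x y].
rewrite -piE; congr (pi _).
by apply/seteqP; split => -[x y].
Qed.

End Propensity.

(** * Inverse propensity weighting *)

Lemma measurable_inv_gt0 d (T : measurableType d) (R : realType) (f : T -> R) :
  measurable_fun setT f -> (forall x, 0 < f x) ->
  measurable_fun setT (fun x => (f x)^-1).
Proof.
move=> mf f0.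
apply: (measurable_comp (F := `]0, +oo[%classic : set R) (f := @GRing.inv R)) => //.
- by move=> _ [x _ <-] /=; rewrite in_itv/= f0.
- apply: open_continuous_measurable_fun; first exact: interval_open.
  move=> x; rewrite inE/= in_itv/= andbT => x0.
  by apply: inv_continuous; rewrite gt_eqF.
Qed.

Section InversePropensity.
Local Open Scope ereal_scope.
Context (R : realType) (n : nat) (X : 'I_n -> polishType R) (E : rel 'I_n).
Variables (j k : 'I_n) (tr : bool -> X j).
Hypothesis tr_bij : bijective tr.

Lemma measurable_treatment_value a : measurable ([set tr a] : set (borel (X j))).
Proof.
rewrite -[[set _]]setCK; apply: (@measurableC _ (borel (X j))).
apply: sub_sigma_algebra; rewrite openC.
exact/accessible_closed_set1/hausdorff_accessible/metric_hausdorff.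
Qed.

Lemma treatment_valueC a : ~` [set tr a] = [set tr (~~ a)].
Proof.
have [g trK gK] := tr_bij; apply/seteqP; split => [x|_ ->] /=.
  by rewrite -(gK x); case: a; case: (g x).
by move=> /(can_inj trK); case: a.
Qed.

(** The overlap condition holds almost everywhere and for arm [true] only. Taking the maximum with
    [delta] changes the propensity on a null set and makes the lower bound hold everywhere;
    [1 + delta] dominates both [delta] and any probability. *)
Lemma overlap_propensity (delta : R) (mu : probability (borel (product_space X)) R)
    (a : bool) : (0 < delta)%R -> overlap_measures E tr delta mu ->
  exists e : borel (product_on X (pa E j)) -> R,
    (forall p, delta <= e p <= 1 + delta)%R /\
    cond_prob mu (restr (pa E j)) (@Defs.coord R _ X j @^-1` [set tr a]) (EFin \o e).
Proof.
move=> d0 [_ [kappa kP kd]].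
have mta := measurable_treatment_value a.
have k1 b p : kappa p [set tr b] <= 1.
  apply: le_trans (sprob_kernel_le1 kappa p); apply: le_measure; rewrite ?inE//.
  exact: measurable_treatment_value.
have kfin b p : kappa p [set tr b] \is a fin_num.
  by rewrite ge0_fin_numE// (le_lt_trans (k1 b p))// ltry.
pose e p := Num.max delta (fine (kappa p [set tr a])).
have mk : measurable_fun setT (fun p => kappa p [set tr a]) by exact: measurable_kernel.
have me : measurable_fun setT e.
  by apply: measurable_maxr => //; exact: measurableT_comp mk.
have rest : measurable_fun setT (@restr R _ X (pa E j)) by exact: measurable_restr.
exists e; split.
  move=> p; rewrite /e le_max lexx/= ge_max lerDr ler01/=.
  by rewrite -lee_fin fineK// (le_trans (k1 a p))// lee_fin lerDl ltW.
have [_ _ kPa] := kP _ mta.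
split => [|p|C mC].
- exact/measurable_EFinP.
- by rewrite lee_fin le_max ltW.
rewrite kPa//.
rewrite -(ge0_integral_law mu rest (k := fun p => kappa p [set tr a]))//.
rewrite -(ge0_integral_law mu rest (k := EFin \o e))//; first last.
- by move=> p; rewrite lee_fin le_max ltW.
- exact/measurable_EFinP.
apply: ae_eq_integral => //.
- exact: measurable_funTS.
- exact/measurable_funTS/measurable_EFinP.
apply: filterS kd => p /andP[dk kd1] _ /=.
rewrite -[LHS](fineK (kfin a p)); congr EFin; apply/esym/max_idPr.
rewrite -lee_fin (fineK (kfin a p)).
(* For arm [false] the lower bound is the upper bound [1 - delta] of arm [true], through total mass
   1. *)
have : kappa p [set tr true] + kappa p [set tr false] = 1.
  have mT := measurable_treatment_value true.
  rewrite -(treatment_valueC true) -measureU ?setICr//; last exact: measurableC.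
  by rewrite setUv; exact: prob_kernel.
move: kd1; case: (a) => //; rewrite -(fineK (kfin true p)) -(fineK (kfin false p)).
by rewrite -EFinD !lee_fin => kd1 [] tf; lra.
Qed.

Lemma measurable_treatment :
  measurable_fun setT (@treatment R _ X E j).
Proof.
apply: (@continuous_borel (product_space X) (treatment_space X E j)) => x.
apply: (@cvg_pair _ _ _ (nbhs x) (nbhs (x j)) (nbhs (@restr R _ X (pa E j) x))
  _ _ _ (fun x => x j) (@restr R _ X (pa E j))).
  exact: (@proj_continuous _ (fun u => X u : ptopologicalType)).
exact: continuous_restr.
Qed.

Lemma measurable_treatment_pair a : measurable_fun setT
  (fun p : borel (product_on X (pa E j)) => (tr a, p) : borel (treatment_space X E j)).
Proof.
apply: (@continuous_borel (product_on X (pa E j)) (treatment_space X E j)) => p.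
exact: (@cvg_pair _ _ _ (nbhs p) (nbhs (tr a)) (nbhs p)
  _ _ _ (cst (tr a)) id (cvg_cst _) cvg_id).
Qed.

(** Insert e / e: [cond_prob_integral] turns the factor e into the indicator of the arm, and
    [cond_law_integral] replaces the inner mean by h(X_k). For nonnegative [h] no integrability has
    to be checked. *)
Lemma adjusted_inverse_propensity (mu : probability (borel (product_space X)) R)
    (kappa : R.-pker (borel (treatment_space X E j)) ~> (borel (X k))) (a : bool)
    (e : borel (product_on X (pa E j)) -> R) (h : borel (X k) -> R) :
  cond_law mu (@treatment R _ X E j) (@Defs.coord R _ X k : _ -> borel (X k)) kappa ->
  (forall p, 0 < e p)%R ->
  cond_prob mu (restr (pa E j)) (@Defs.coord R _ X j @^-1` [set tr a]) (EFin \o e) ->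
  measurable_fun setT h -> (forall y, 0 <= h y)%R ->
  \int[distribution mu (restr (pa E j))]_p \int[kappa (tr a, p)]_y (h y)%:E =
  \int[mu]_x (\1_[set tr a] (x j) / e (restr (pa E j) x) * h (x k))%:E.
Proof.
move=> kP e0 eP mh h0; have [me _ _] := eP.
have mta := measurable_treatment_value a.
pose g (s : borel (treatment_space X E j)) : \bar R := \int[kappa s]_y (h y)%:E.
have mg : measurable_fun setT g.
  apply: measurable_fun_integral_kernel.
  - by move=> B mB; exact: measurable_kernel.
  - by move=> y; rewrite lee_fin.
  - exact/measurable_EFinP.
have g0 s : 0 <= g s by apply: integral_ge0 => y _; rewrite lee_fin.
pose ga (p : borel (product_on X (pa E j))) : \bar R := g (tr a, p).
have mga : measurable_fun setT ga.
  exact: (measurableT_comp mg (measurable_treatment_pair a)).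
have meV : measurable_fun setT (fun p => ((e p)^-1)%:E : \bar R).
  apply/measurable_EFinP/measurable_inv_gt0 => //; exact/measurable_EFinP.
have m1 : measurable_fun setT (fun s : borel (treatment_space X E j) => s.1 : borel (X j)).
  apply: (@continuous_borel (treatment_space X E j) (X j)) => s; exact: cvg_fst.
have m2 : measurable_fun setT
    (fun s : borel (treatment_space X E j) => s.2 : borel (product_on X (pa E j))).
  apply: (@continuous_borel (treatment_space X E j) (product_on X (pa E j))) => s.
  exact: cvg_snd.
pose phi (s : borel (treatment_space X E j)) : \bar R :=
  (\1_[set tr a] s.1 / e s.2)%:E.
have mphi : measurable_fun setT phi.
  apply/measurable_EFinP/measurable_funM.
    exact: measurable_indic (preimage_measurable m1 mta).
  apply: (measurableT_comp (f := fun p => (e p)^-1%R) _ m2).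
  exact/measurable_EFinP.
have phi0 s : 0 <= phi s.
  by rewrite lee_fin mulr_ge0// invr_ge0 ltW.
have mrestr := @measurable_restr R n X (pa E j).
transitivity (\int[mu]_x ga (restr (pa E j) x)).
  exact: (ge0_integral_law mu mrestr measurableT mga (fun p => g0 _)).
transitivity (\int[mu]_x (((e (restr (pa E j) x))^-1)%:E * ga (restr (pa E j) x)
    * (e (restr (pa E j) x))%:E)).
  apply: eq_integral => x _; rewrite muleAC -EFinM mulVf ?mul1e//.
  by rewrite gt_eqF.
rewrite -(cond_prob_integral (phi := fun p => ((e p)^-1)%:E * ga p) mrestr _ eP)//;
  first last.
- by move=> p; apply: mule_ge0; [rewrite lee_fin invr_ge0 ltW|exact: g0].
- exact: emeasurable_funM.
- by apply: preimage_measurable mta; exact: measurable_coord.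
transitivity (\int[mu]_x (phi (treatment E j x) * g (treatment E j x))).
  rewrite -integral_indicM; apply: eq_integral => x _.
  rewrite /phi/= EFinM -muleA; have [xj|nxj] := pselect (x j = tr a).
    by rewrite /ga -xj.
  by rewrite !indicE !memNset//= !mul0e.
rewrite -(cond_law_integral measurable_treatment _ kP)//.
- exact: measurable_coord.
- exact/measurable_EFinP.
Qed.

End InversePropensity.

(** * The Lipschitz estimate *)

Lemma continuous_mdist (R : realType) (T : metricType R) :
  continuous (fun p : T * T => mdist p.1 p.2).
Proof.
move=> [x y]; apply/cvgrPdist_lt => eps e0 /=.
have e20 : 0 < eps / 2 by rewrite divr_gt0.
near=> p; rewrite ltr_norml.
have [] : ball x (eps / 2) p.1 /\ ball y (eps / 2) p.2.
  near: p; exists (ball x (eps / 2), ball y (eps / 2)) => //=.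
  by split; exact: nbhsx_ballx.
 rewrite !ballEmdist/= => xp yp.
have t1 := metric_triangle x p.1 y; have t2 := metric_triangle p.1 p.2 y.
have t3 := metric_triangle p.1 x p.2; have t4 := metric_triangle x y p.2.
have s1 := metric_sym p.1 x; have s2 := metric_sym p.2 y.
by apply/andP; split; lra.
Unshelve. all: by end_near. Qed.

(** [adjusted_mean] is an iterated real integral of a signed function, whereas the kernel lemmas
    treat nonnegative extended integrands; the shift by [M] connects them. The first conclusion
    keeps the inner mean within the same bound, so the lemma applies again to the outer integral. *)
Lemma Rintegral_shift d (T : measurableType d) (R : realType)
    (m : {measure set T -> \bar R}) (f : T -> R) (M : R) :
  m setT = 1%E -> measurable_fun setT f -> (forall x, `|f x| <= M) ->
  `|Rintegral m setT f| <= M /\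
  ((Rintegral m setT f + M)%:E = \int[m]_x (f x + M)%:E)%E.
Proof.
move=> m1 mf fM.
have fi : m.-integrable setT (EFin \o f).
  apply: measurable_bounded_integrable => //; first by rewrite m1 ltry.
  exists M; split; first exact: num_real.
  by move=> y My x _; exact: le_trans (fM x) (ltW My).
have ci (c : R) : m.-integrable setT (EFin \o cst c).
  apply: measurable_bounded_integrable => //; first by rewrite m1 ltry.
  exists `|c|; split; first exact: num_real.
  by move=> y My x _; exact: ltW.
split.
  rewrite -lee_fin EFin_normr_Rintegral//.
  apply: le_trans (le_abse_integral _ _ _) _ => //; first exact/measurable_EFinP.
  apply: (@le_trans _ _ (\int[m]_x (cst M%:E x))%E); last first.
    by rewrite integral_cst// m1 mule1.
  apply: ge0_le_integral => //.
  - by apply: measurableT_comp => //; exact/measurable_EFinP.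
  - by move=> x _; rewrite lee_fin.
rewrite (integralD_EFin measurableT fi (ci M)).
rewrite [X in (_ + X)%E](integral_cst m measurableT M%:E) m1 mule1 EFinD.
by rewrite /Rintegral fineK//; exact: integrable_fin_num.
Qed.

(* The factors of the inverse propensity weighted outcome i * h / e vary
   one at a time. *)
Lemma weighted_outcome_dist (R : realFieldType) (delta M i i' e e' h h' : R) :
  0 < delta -> 0 <= i <= 1 -> delta <= e -> delta <= e' -> 0 <= h' <= M ->
  `|i / e * h - i' / e' * h'| <=
  delta^-1 * `|h - h'| + M / delta * `|i - i'| + M / delta ^+ 2 * `|e - e'|.
Proof.
move=> d0 /andP[i0 i1] de de' /andP[h'0 h'M].
have e0 : 0 < e by exact: lt_le_trans de.
have e'0 : 0 < e' by exact: lt_le_trans de'.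
have eV : e^-1 <= delta^-1 by rewrite lef_pV2.
have e'V : e'^-1 <= delta^-1 by rewrite lef_pV2.
have eV0 : 0 <= e^-1 by rewrite invr_ge0 ltW.
have e'V0 : 0 <= e'^-1 by rewrite invr_ge0 ltW.
have M0 : 0 <= M by exact: le_trans h'M.
have ieV : i / e <= delta^-1 by rewrite -[leRHS]mul1r; exact: ler_pM.
rewrite (_ : _ - _ = i / e * (h - h') + h' / e' * (i - i')
    + h' * (i * e^-1 * e'^-1) * (e' - e)); last first.
  by field; rewrite !gt_eqF.
rewrite (le_trans (ler_normD _ _))// lerD ?(le_trans (ler_normD _ _))// ?lerD//.
- by rewrite normrM ger0_norm ?mulr_ge0// ler_wpM2r.
- by rewrite normrM ger0_norm ?mulr_ge0// ler_wpM2r// ler_pM.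
- rewrite normrM (distrC e') ger0_norm ?mulr_ge0// ler_wpM2r//.
  rewrite expr2 invfM; apply: ler_pM => //; rewrite ?mulr_ge0//.
  apply: ler_pM; rewrite ?mulr_ge0//.
Qed.

Section AverageTreatmentEffect.
Context (R : realType) (n : nat) (X : 'I_n -> polishType R) (E : rel 'I_n).
Variables (j k : 'I_n) (tr : bool -> X j) (rv : X k -> R) (delta M : R).
Hypothesis sE : sorted_dag E.
Hypothesis tr_bij : bijective tr.
Hypothesis tr_dist : forall a b : bool, mdist (tr a) (tr b) = `|a%:R - b%:R| :> R.
Hypothesis rv_dist : forall x y : X k, mdist x y = `|rv x - rv y|.
Hypothesis rv_bound : forall x, `|rv x| <= M.
Hypothesis delta_gt0 : 0 < delta.

Let M_ge0 : 0 <= M.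
Proof. exact: le_trans (rv_bound point). Qed.

Let measurable_rv : measurable_fun setT (rv : borel (X k) -> R).
Proof. by apply: continuous_borel_real; exact: continuous_isometry. Qed.

(** Exchanging 0 and 1 preserves distances, so for a binary treatment the indicator of either arm is
    an isometry. This makes the indicator term one summand of the distance on the product. *)
Lemma indic_treatment_dist (a : bool) (x y : X j) :
  `|\1_[set tr a] x - \1_[set tr a] y| = mdist x y :> R.
Proof.
have [g trK gK] := tr_bij; rewrite -(gK x) -(gK y) tr_dist.
have ind b : \1_[set tr a] (tr b) = (b == a)%:R :> R.
  rewrite indicE; congr (nat_of_bool _)%:R; apply/idP/eqP => [|->]; rewrite inE//=.
  by move=> /(can_inj trK).
rewrite !ind; case: a {ind}; case: (g x); case: (g y) => //=;
  by rewrite ?subrr// distrC.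
Qed.

Definition weighted_outcome (e : borel (product_on X (pa E j)) -> R) (a : bool)
    (x : borel (product_space X)) : R :=
  \1_[set tr a] (x j) / e (restr (pa E j) x) * (rv (x k) + M).

Lemma adjusted_meanE (mu : probability (borel (product_space X)) R)
    (kappa : R.-pker (borel (treatment_space X E j)) ~> (borel (X k))) (a : bool)
    (e : borel (product_on X (pa E j)) -> R) :
  cond_law mu (@treatment R _ X E j) (@Defs.coord R _ X k : _ -> borel (X k)) kappa ->
  (forall p, delta <= e p) ->
  cond_prob mu (restr (pa E j)) (@Defs.coord R _ X j @^-1` [set tr a]) (EFin \o e) ->
  ((adjusted_mean tr rv mu kappa a + M)%:E =
   \int[mu]_x (weighted_outcome e a x)%:E)%E.
Proof.
move=> kP de eP.
have mh : measurable_fun setT (fun y : borel (X k) => rv y + M) by exact: measurable_funD.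
have h0 (y : borel (X k)) : 0 <= rv y + M.
  by have := rv_bound y; rewrite ler_norml => /andP[]; lra.
rewrite -(adjusted_inverse_propensity kP _ eP mh h0); last first.
  by move=> p; exact: lt_le_trans (de p).
have measurable_inner : measurable_fun setT
    (fun p : borel (product_on X (pa E j)) => (\int[kappa (tr a, p)]_y (rv y + M)%:E)%E).
  apply: (measurableT_comp (f := fun s => (\int[kappa s]_y (rv y + M)%:E)%E)
    _ (@measurable_treatment_pair R n X E j tr a)).
  apply: measurable_fun_integral_kernel.
  - by move=> B mB; exact: measurable_kernel.
  - by move=> y; rewrite lee_fin.
  - exact/measurable_EFinP.
have inner p : `|Rintegral (kappa (tr a, p)) setT rv| <= M /\
    ((Rintegral (kappa (tr a, p)) setT rv + M)%:E =
     \int[kappa (tr a, p)]_y (rv y + M)%:E)%E.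
  by apply: Rintegral_shift => //; exact: prob_kernel.
have mr : measurable_fun setT (fun p : borel (product_on X (pa E j)) =>
    Rintegral (kappa (tr a, p)) setT rv).
  (* Measurability of the real inner mean is read off from the shifted extended integral. *)
  apply: (eq_measurable_fun (fun p : borel (product_on X (pa E j)) =>
      fine (\int[kappa (tr a, p)]_y (rv y + M)%:E)%E - M)).
    by move=> p _; have [_ <-] := inner p; rewrite /= addrK.
  by apply: measurable_funB => //; exact: measurableT_comp measurable_inner.
have [_ ->] := @Rintegral_shift _ _ R (distribution mu (restr (pa E j))) _ M
  (probability_setT _) mr (fun p => (inner p).1).
by apply: eq_integral => p _; have [_ ->] := inner p.
Qed.


Lemma measurable_weighted_outcome e a : measurable_fun setT e ->
  (forall p, delta <= e p) -> measurable_fun setT (weighted_outcome e a).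
Proof.
move=> me de.
have mj : measurable_fun setT (@Defs.coord R _ X j : _ -> borel (X j)).
  exact: measurable_coord.
have mk : measurable_fun setT (@Defs.coord R _ X k : _ -> borel (X k)).
  exact: measurable_coord.
apply: measurable_funM.
  apply: measurable_funM.
    exact: measurable_indic (preimage_measurable mj (measurable_treatment_value tr a)).
  apply: (measurableT_comp (f := fun p => (e p)^-1)); last exact: measurable_restr.
  by apply: measurable_inv_gt0 => // p; exact: lt_le_trans (de p).
apply: measurable_funD => //.
exact: measurableT_comp measurable_rv mk.
Qed.

Lemma weighted_outcome_bound e a x : (forall p, delta <= e p) ->
  0 <= weighted_outcome e a x <= delta^-1 * (M + M).
Proof.
move=> de; have := rv_bound (x k); rewrite ler_norml => /andP[? ?].
have e0 := lt_le_trans delta_gt0 (de (restr (pa E j) x)).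
have i01 : 0 <= (\1_[set tr a] (x j) : R) <= 1.
  by rewrite indicE; case: (_ \in _); rewrite ?lexx ?ler01.
have [i0 i1] := andP i01.
apply/andP; split.
  by rewrite !mulr_ge0// ?invr_ge0 ?(ltW e0)//; lra.
apply: ler_pM; rewrite ?mulr_ge0// ?invr_ge0 ?(ltW e0)//; [lra| |lra].
by rewrite -[leRHS]mul1r; apply: ler_pM; rewrite ?invr_ge0 ?(ltW e0)// lef_pV2.
Qed.

Lemma coupling_integral_snd (mu nu : probability (borel (product_space X)) R)
    (pi : probability (borel (pair_space X X)) R)
    (g : borel (product_space X) -> \bar R) :
  couplings mu nu pi -> measurable_fun setT g -> (forall x, 0 <= g x)%E ->
  (\int[nu]_x g x = \int[pi]_z g z.2)%E.
Proof.
move=> [_ pi2] mg g0.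
rewrite -(ge0_integral_law pi (@measurable_snd_pair R n X) measurableT mg g0).
by apply: eq_measure_integral => C mC _; exact: (esym (pi2 C mC)).
Qed.

(** This rules out the default value of [xget]: compactness of the range of [rv] gives the
    retraction from which a conditional law of X_k is built. *)
Lemma ate_attained (mu : probability (borel (product_space X)) R) :
  compact (range rv) ->
  exists2 kappa : R.-pker (borel (treatment_space X E j)) ~> (borel (X k)),
    cond_law mu (@treatment R _ X E j) (@Defs.coord R _ X k : _ -> borel (X k)) kappa &
    ate E tr rv mu = `|adjusted_mean tr rv mu kappa true -
                       adjusted_mean tr rv mu kappa false|.
Proof.
move=> cpt; rewrite /ate.
have [r mr rK] := isometry_retract cpt rv_dist.
have mrvE : measurable_fun setT (EFin \o rv : borel (X k) -> \bar R).
  exact/measurable_EFinP.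
have [kappa kP] := cond_law_exists mu (@measurable_treatment R n X E j)
  (@measurable_coord R n X k) mrvE mr rK.
exact: (xgetPex 0 (ex_intro [set r | exists2 kappa : R.-pker _ ~> _,
    cond_law mu (@treatment R _ X E j) (@Defs.coord R _ X k : _ -> borel (X k)) kappa &
    r = `|adjusted_mean tr rv mu kappa true - adjusted_mean tr rv mu kappa false|]
  _ (ex_intro2 _ _ kappa kP erefl))).
Qed.


Lemma measurable_mdist_coord (i : 'I_n) : measurable_fun setT
  (fun z : borel (pair_space X X) => mdist (z.1 i) (z.2 i) : R).
Proof.
apply: (@continuous_borel_real R (pair_space X X)) => z.
have c1 := @continuous_pair_proj R _ X X (inl i) z.
have c2 := @continuous_pair_proj R _ X X (inr i) z.
apply: (@continuous_comp (pair_space X X) (X i * X i)%type R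
  (fun z : pair_space X X => (z.1 i, z.2 i)) (fun p => mdist p.1 p.2)).
  exact: (cvg_pair c1 c2).
exact: continuous_mdist.
Qed.

Lemma mdist_le_sum_dist (i : 'I_n) (x y : product_space X) :
  mdist (x i) (y i) <= sum_dist x y :> R.
Proof.
rewrite /sum_dist (bigD1 i)//= lerDl; apply: sumr_ge0 => l _; exact: mdist_ge0.
Qed.

(** The sum of the three coefficients in [weighted_outcome_dist], with outcomes shifted into
    [0, 2M]; each of the three mean distances they multiply is at most the transport cost. *)
Definition adjustment_lipschitz : R :=
  delta^-1 + (M + M) / delta + (M + M) / delta ^+ 2.

Lemma adjustment_lipschitz_gt0 : 0 < adjustment_lipschitz.
Proof.
rewrite /adjustment_lipschitz -addrA ltr_wpDr ?invr_gt0// addr_ge0//.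
  by rewrite divr_ge0 ?addr_ge0// ltW.
by rewrite divr_ge0 ?addr_ge0// exprn_ge0// ltW.
Qed.

Lemma adjusted_mean_dist_le (E' : rel 'I_n)
    (mu nu : probability (borel (product_space X)) R)
    (pi : probability (borel (pair_space X X)) R)
    (kappa kappa' : R.-pker (borel (treatment_space X E j)) ~> (borel (X k)))
    (a : bool) :
  sorted_dag E' -> subrel E E' ->
  overlap_measures E tr delta mu -> overlap_measures E tr delta nu ->
  bicausal_couplings E' mu nu pi ->
  cond_law mu (@treatment R _ X E j) (@Defs.coord R _ X k : _ -> borel (X k)) kappa ->
  cond_law nu (@treatment R _ X E j) (@Defs.coord R _ X k : _ -> borel (X k)) kappa' ->
  (`|adjusted_mean tr rv mu kappa a - adjusted_mean tr rv nu kappa' a|%:E <=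
   adjustment_lipschitz%:E * \int[pi]_z (sum_dist z.1 z.2)%:E)%E.
Proof.
move=> sE' EE' omu onu bc kP kP'.
have [cpi _] := bc; have [cou _] := cpi.
have [e [e_bd eP]] := overlap_propensity tr_bij a delta_gt0 omu.
have [e' [e'_bd e'P]] := overlap_propensity tr_bij a delta_gt0 onu.
have de p : delta <= e p by have /andP[] := e_bd p.
have de' p : delta <= e' p by have /andP[] := e'_bd p.
have me : measurable_fun setT e by have [/measurable_EFinP] := eP.
have me' : measurable_fun setT e' by have [/measurable_EFinP] := e'P.
have mta := measurable_treatment_value tr a.
have mw := measurable_weighted_outcome a me de.
have mw' := measurable_weighted_outcome a me' de'.
have wb x := weighted_outcome_bound a x de.
have wb' x := weighted_outcome_bound a x de'.
pose F (z : borel (pair_space X X)) := weighted_outcome e a z.1.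
pose G (z : borel (pair_space X X)) := weighted_outcome e' a z.2.
have mF : measurable_fun setT F.
  exact: (measurableT_comp mw (@measurable_fst_pair R n X)).
have mG : measurable_fun setT G.
  exact: (measurableT_comp mw' (@measurable_snd_pair R n X)).
have FE : ((adjusted_mean tr rv mu kappa a + M)%:E = \int[pi]_z (F z)%:E)%E.
  rewrite (adjusted_meanE kP de eP) (coupling_integral_fst cpi)//.
  - exact/measurable_EFinP.
  - by move=> x; rewrite lee_fin; have /andP[] := wb x.
have GE : ((adjusted_mean tr rv nu kappa' a + M)%:E = \int[pi]_z (G z)%:E)%E.
  rewrite (adjusted_meanE kP' de' e'P) (coupling_integral_snd cou)//.
  - exact/measurable_EFinP.
  - by move=> x; rewrite lee_fin; have /andP[] := wb' x.
have iF : pi.-integrable setT (EFin \o F).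
  exact: (ge0_bounded_integrable pi measurableT mF (fun z => wb z.1)).
have iG : pi.-integrable setT (EFin \o G).
  exact: (ge0_bounded_integrable pi measurableT mG (fun z => wb' z.2)).
have FGE : ((adjusted_mean tr rv mu kappa a - adjusted_mean tr rv nu kappa' a)%:E
    = \int[pi]_z (F z - G z)%:E)%E.
  under eq_integral do rewrite EFinB.
  rewrite (integralB_EFin measurableT iF iG) -FE -GE -EFinB; congr EFin; lra.
pose I z : R := `|\1_[set tr a] (z.1 j) - \1_[set tr a] (z.2 j)|.
pose D z : R := `|e (restr (pa E j) z.1) - e' (restr (pa E j) z.2)|.
pose K z : R := `|rv (z.1 k) - rv (z.2 k)|.
pose S : \bar R := (\int[pi]_z (sum_dist z.1 z.2)%:E)%E.
have mS : measurable_fun setT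
    (fun z : borel (pair_space X X) => sum_dist z.1 z.2 : R).
  by apply: measurable_sum => i; exact: measurable_mdist_coord.
have S_ge (i : 'I_n) : (\int[pi]_z (mdist (z.1 i) (z.2 i) : R)%:E <= S)%E.
  apply: ge0_le_integral => //.
  - by move=> z _; rewrite lee_fin mdist_ge0.
  - by apply/measurable_EFinP; exact: measurable_mdist_coord.
  - exact/measurable_EFinP.
  - by move=> z _; rewrite lee_fin; exact: mdist_le_sum_dist.
have IE : I = fun z => mdist (z.1 j) (z.2 j).
  by apply/funext => z; exact: indic_treatment_dist.
have KE : K = fun z => mdist (z.1 k) (z.2 k).
  by apply/funext => z; rewrite rv_dist.
have mI : measurable_fun setT (I : borel (pair_space X X) -> R).
  by rewrite IE; exact: measurable_mdist_coord.
have mK : measurable_fun setT (K : borel (pair_space X X) -> R).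
  by rewrite KE; exact: measurable_mdist_coord.
have mD : measurable_fun setT (D : borel (pair_space X X) -> R).
  apply: measurableT_comp => //; apply: measurable_funB.
    exact: (measurableT_comp me (@measurable_restr_fst R n X (pa E j))).
  exact: (measurableT_comp me' (@measurable_restr_snd R n X (pa E j))).
have IS : (\int[pi]_z (I z)%:E <= S)%E by rewrite IE; exact: S_ge.
have KS : (\int[pi]_z (K z)%:E <= S)%E by rewrite KE; exact: S_ge.
(* The propensity term has no counterpart in the metric; bicausality reduces it to the treatment
   term. *)
have DS : (\int[pi]_z (D z)%:E <= S)%E.
  apply: le_trans IS; apply: (bicausal_propensity sE sE' EE' omu.1 onu.1 bc mta
    (M := 1 + delta)) => //; first by rewrite lerDl ltW.
  - by move=> p; have /andP[ep ->] := e_bd p; rewrite (le_trans (ltW delta_gt0)).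
  - by move=> p; have /andP[ep ->] := e'_bd p; rewrite (le_trans (ltW delta_gt0)).
have S0 : (0 <= S)%E.
  by apply: le_trans (S_ge j); apply: integral_ge0 => z _; rewrite lee_fin mdist_ge0.
have c1 : 0 <= delta^-1 by rewrite invr_ge0 ltW.
have MM : 0 <= M + M by rewrite addr_ge0.
have c2 : 0 <= (M + M) / delta by rewrite divr_ge0// ltW.
have c3 : 0 <= (M + M) / delta ^+ 2 by rewrite divr_ge0// exprn_ge0// ltW.
apply: (@le_trans _ _ (\int[pi]_z (delta^-1%:E * (K z)%:E +
    ((M + M) / delta)%:E * (I z)%:E + ((M + M) / delta ^+ 2)%:E * (D z)%:E))%E).
  rewrite -[leLHS]/(`| (_ - _)%:E |)%E FGE.
  apply: le_trans (le_abse_integral _ _ _) _ => //.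
    by apply/measurable_EFinP; exact: measurable_funB.
  apply: ge0_le_integral => //.
  - apply: measurableT_comp => //; apply/measurable_EFinP; exact: measurable_funB.
  - by apply: emeasurable_funD; [apply: emeasurable_funD|]; apply: measurable_funeM;
      exact/measurable_EFinP.
  - move=> z _; rewrite -!EFinM -!EFinD lee_fin.
    have := rv_bound (z.2 k); rewrite ler_norml => /andP[? ?].
    have -> : K z = `|(rv (z.1 k) + M) - (rv (z.2 k) + M)|.
      by rewrite /K opprD addrACA subrr addr0.
    apply: weighted_outcome_dist => //.
      by rewrite indicE; case: (_ \in _); rewrite ?lexx ?ler01.
    by apply/andP; split; lra.
have mc (c : R) (f : borel (pair_space X X) -> R) : measurable_fun setT f ->
    measurable_fun setT (fun z => (c%:E * (f z)%:E)%E).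
  by move=> mf; apply: measurable_funeM; exact/measurable_EFinP.
have c0 (c t : R) : 0 <= c -> (0 <= c%:E * `|t|%:E)%E.
  by move=> ?; rewrite mule_ge0 ?lee_fin.
rewrite ge0_integralD//; first last.
- exact: mc.
- by move=> z _; exact: c0.
- by apply: emeasurable_funD; exact: mc.
- by move=> z _; apply: adde_ge0; exact: c0.
rewrite ge0_integralD//; first last.
- exact: mc.
- by move=> z _; exact: c0.
- exact: mc.
- by move=> z _; exact: c0.
rewrite !ge0_integralZl_EFin//; do ?[exact/measurable_EFinP|
  by move=> z _; rewrite lee_fin normr_ge0].
rewrite /adjustment_lipschitz !EFinD !ge0_muleDl ?adde_ge0 ?lee_fin//.
by rewrite leeD ?leeD// lee_wpmul2l ?lee_fin.
Qed.


(** The factor 2 counts the treatment arms. The constant depends on [delta] and [M] only, so it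
    serves all couplings and all graphs [E']. *)
Lemma ate_dist_le_wasserstein (E' : rel 'I_n)
    (mu nu : probability (borel (product_space X)) R) :
  compact (range rv) -> sorted_dag E' -> subrel E E' ->
  overlap_measures E tr delta mu -> overlap_measures E tr delta nu ->
  (`|ate E tr rv mu - ate E tr rv nu|%:E <=
   (2 * adjustment_lipschitz)%:E * wasserstein E' (@sum_dist R _ X) mu nu)%E.
Proof.
move=> cpt sE' EE' omu onu.
have L0 : 0 < 2 * adjustment_lipschitz by rewrite mulr_gt0// adjustment_lipschitz_gt0.
have [kappa kP ->] := ate_attained mu cpt.
have [kappa' kP' ->] := ate_attained nu cpt.
(* With the positive constant on the left, each coupling can be treated alone; the infimum over an
   empty set of couplings is [+oo]. *)
rewrite -lee_pdivrMl//; apply: le_ereal_inf_tmp => _ [pi bc <-].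
rewrite lee_pdivrMl//.
have ht := adjusted_mean_dist_le true sE' EE' omu onu bc kP kP'.
have hf := adjusted_mean_dist_le false sE' EE' omu onu bc kP kP'.
have S0 : (0 <= \int[pi]_z (sum_dist z.1 z.2)%:E)%E.
  apply: integral_ge0 => z _; rewrite lee_fin.
  by apply: sumr_ge0 => i _; exact: mdist_ge0.
apply: (@le_trans _ _ (`|adjusted_mean tr rv mu kappa true -
    adjusted_mean tr rv nu kappa' true| + `|adjusted_mean tr rv mu kappa false -
    adjusted_mean tr rv nu kappa' false|)%:E).
  have dist_dist (a b c d : R) :
      `| `|a - b| - `|c - d| | <= `|a - c| + `|b - d|.
    apply: le_trans (ler_dist_dist _ _) _.
    have -> : a - b - (c - d) = (a - c) - (b - d) by ring.
    exact: ler_normB.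
  by rewrite lee_fin; exact: dist_dist.
rewrite EFinD; apply: le_trans (leeD ht hf) _.
rewrite -ge0_muleDl ?lee_fin ?(ltW adjustment_lipschitz_gt0)//.
by rewrite -EFinD -mulr2n mulr_natl.
Qed.

End AverageTreatmentEffect.

Lemma sorted_complete_graph (n : nat) : sorted_dag (@complete_graph n).
Proof.
have lt (i j : 'I_n) : i \in pa (@complete_graph n) j -> (i < j)%N.
  by rewrite finset.inE.
split => // i; apply/negP; rewrite finset.inE => /existsP[l /andP[il li]].
have : (l <= i)%N by apply: (connect_rank (rank := val)) li => s t /ltnW.
by rewrite leqNgt (il : (i < l)%N).
Qed.

Theorem corollary3p7 (R : realType) (n : nat) (X : 'I_n -> polishType R)
    (E : rel 'I_n) (j k : 'I_n) (tr : bool -> X j) (rv : X k -> R) (delta : R)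
    (E' : rel 'I_n) :
  sorted_dag E ->
  (j < k)%N ->
  bijective tr ->
  (forall a b : bool, mdist (tr a) (tr b) = `|a%:R - b%:R| :> R) ->
  compact (range rv) ->
  (forall x y : X k, mdist x y = `|rv x - rv y|) ->
  0 < delta ->
  sorted_dag E' ->
  subrel E E' ->
  (exists2 L : R, 0 < L &
     forall mu nu : probability (borel (product_space X)) R,
       overlap_measures E tr delta mu -> overlap_measures E tr delta nu ->
       (`|ate E tr rv mu - ate E tr rv nu|%:E
          <= L%:E * wasserstein E' (@sum_dist R _ X) mu nu)%E) /\
  (exists2 L : R, 0 < L &
     forall mu nu : probability (borel (product_space X)) R,
       overlap_measures E tr delta mu -> overlap_measures E tr delta nu ->
       (`|ate E tr rv mu - ate E tr rv nu|%:E
          <= L%:E * adapted_wasserstein (@sum_dist R _ X) mu nu)%E).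
Proof.
move=> sE jk tr_bij tr_dist cpt rv_dist d0 sE' EE'.
have [M rvM] : exists M, forall x, `|rv x| <= M.
  have [M [_ MP]] := compact_bounded cpt.
  (* Boundedness is stated for all numbers strictly above [M], hence [M + 1]. *)
  by exists (M + 1) => x; apply: (MP (M + 1)); [rewrite ltrDl|exists x].
have L0 : 0 < 2 * adjustment_lipschitz delta M.
  by rewrite mulr_gt0// (adjustment_lipschitz_gt0 rvM).
split; exists (2 * adjustment_lipschitz delta M).
- exact: L0.
- by move=> mu nu; exact: ate_dist_le_wasserstein.
- exact: L0.
(* The adapted distance is the case of the complete graph, which contains every sorted graph. *)
- move=> mu nu; apply: ate_dist_le_wasserstein => //.
    exact: sorted_complete_graph.
  by move=> i l il; apply: sE.2; rewrite finset.inE.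
Qed.
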